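(* Let $\Phi:W\to\Omega\subset\mathbb C^2$ be a biholomorphic embedding induced by a polynomial map, defined in a neighborhood $W$ of the closed bidisc $\overline{\mathbb D}^2$, with $\Phi(0)=0$, and set $$T=\Phi(\mathbb T^2),\qquad \mathbb T^2=\{(z,w):|z|=|w|=1\}.$$ Let $\mathcal F$ be a one-dimensional holomorphic foliation. Assume that $T\subset S^3(R)$ for some $R>0$, that $\mathcal F$ is holomorphic in a neighborhood of $\overline\Omega$, that $$T\subset M(\mathcal F,S^3(R)),$$ and that $0=\Phi(0)$ is an isolated nondegenerate Siegel singularity of $\mathcal F$. Then $\Phi$ is linear, up to a unitary change of target coordinates, and the germ of $\mathcal F$ at $0$ is analytically linearizable as a Siegel type singularity.
   Context: $\mathbb D\subset\mathbb C$ is the open unit disc and $S^3(R)=\{(x,y)\in\mathbb C^2:|x|^2+|y|^2=R^2\}$. The set $\Omega$ is the image of $\Phi$. A one-dimensional holomorphic foliation is locally generated by a holomorphic vector field with isolated singularities (unique up to a holomorphic unit). A singularity is nondegenerate if the linear part of a local generator there is invertible; it is a (nondegenerate) Siegel singularity if moreover the ratio of the two eigenvalues is a negative real number. The germ at $0$ is analytically linearizable of Siegel type if there is a local biholomorphism $\Psi:(\mathbb C^2,0)\to(\mathbb C^2,0)$ with $\Psi_*\mathcal F$ given by $z\,dw-\tau w\,dz=0$, $\tau\in\mathbb R_{<0}$. For a smooth real hypersurface $H\subset\mathbb C^2$ and a point $p\in H$ at which $\mathcal F$ is regular, $\mathcal F$ is complex tangent to $H$ at $p$ if the tangent line of $\mathcal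 F$ at $p$ is contained in the complex tangent line $T_p^{\mathbb C}H$. $M(\mathcal F,H)$ denotes the set of such points $p$. *)

(* Defs.v *)
From HB Require Import structures.
From mathcomp Require Import all_boot all_order all_algebra.
From mathcomp Require Import complex.
From mathcomp Require Import all_classical all_reals all_analysis.

Set Implicit Arguments.
Unset Strict Implicit.
Unset Printing Implicit Defensive.

Import Order.TTheory GRing.Theory Num.Theory.
Import numFieldNormedType.Exports.

Local Open Scope classical_set_scope.
Local Open Scope ring_scope.
Local Open Scope complex_scope.

(* R[i] as a numClosedFieldType, so that it inherits the topology and norm of
   an abstract field of this kind.  The order is the partial order in which
   0 < x forces x to be real: a < 0 means that a is a negative real number. *)
Definition Cplx (R : realType) : numClosedFieldType := R[i].

(* Points of C^2 are row vectors (z, w); matrices act on the right. *)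
Notation C2 R := 'rV[Cplx R]_2.

Section SeveralComplexVariables.
Variable R : realType.
Local Notation C := (Cplx R).

(* [differentiable] is the Frechet derivative over the scalar field of the
   spaces involved, here C: the differential is required to be C-linear. *)
Definition holomorphic (E : normedModType C) (A : set (C2 R)) (f : C2 R -> E) :=
  forall p, A p -> differentiable f p.

Definition biholomorphic (A B : set (C2 R)) (f : C2 R -> C2 R) :=
  [/\ open A, open B, holomorphic A f, f @` A = B &
      exists g : C2 R -> C2 R,
        [/\ holomorphic B g, g @` B = A & forall p, A p -> g (f p) = p]].

(* The outer variable of P j is w, the inner one is z. *)
Definition polynomial_on (A : set (C2 R)) (f : C2 R -> C2 R) :=
  exists P : 'I_2 -> {poly {poly C}},
    forall p, A p -> forall j, f p 0 j = (P j).[(p 0 1)%:P].[p 0 0].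

Definition closed_bidisc : set (C2 R) :=
  [set p | `|p 0 0| <= 1 /\ `|p 0 1| <= 1].

Definition torus2 : set (C2 R) := [set p | `|p 0 0| = 1 /\ `|p 0 1| = 1].

Definition sphere3 (r : R) : set (C2 R) :=
  [set p | `|p 0 0| ^+ 2 + `|p 0 1| ^+ 2 = r%:C ^+ 2].

(* Velocities at p of curves contained in H; when H is a smooth hypersurface
   this is its real tangent space at p. *)
Definition tangent_space (H : set (C2 R)) (p : C2 R) : set (C2 R) :=
  [set v | exists g : R -> C2 R,
     [/\ g 0 = p, forall t, H (g t) &
         (fun t : R => (t^-1)%:C *: (g t - p)) @ (0 : R)^' --> v]].

Definition complex_tangent_space (H : set (C2 R)) (p : C2 R) : set (C2 R) :=
  [set v | tangent_space H p v /\ tangent_space H p ('i *: v)].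

(* One-dimensional holomorphic foliation on an open set D, given by an atlas
   of local generators. *)
Record foliation (D : set (C2 R)) := Foliation {
  fol_chart : Type;
  fol_dom : fol_chart -> set (C2 R);
  fol_gen : fol_chart -> C2 R -> C2 R;
  fol_open : forall k, open (fol_dom k);
  fol_cover : \bigcup_(k in [set: fol_chart]) fol_dom k = D;
  fol_holo : forall k, holomorphic (fol_dom k) (fol_gen k);
  fol_isolated : forall k p, fol_dom k p -> fol_gen k p = 0 ->
    \forall q \near p^', fol_gen k q != 0;
  fol_unit : forall k l, exists u : C2 R -> C,
    holomorphic (fol_dom k `&` fol_dom l) u /\
    (forall p, fol_dom k p -> fol_dom l p ->
       u p != 0 /\ fol_gen k p = u p *: fol_gen l p) }.

Section Foliation.
Variables (D : set (C2 R)) (F : foliation D).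

Definition regular_at (p : C2 R) :=
  exists2 k : fol_chart F, fol_dom k p & fol_gen k p != 0.

Definition tangent_line (p : C2 R) : set (C2 R) :=
  [set v | exists2 k : fol_chart F, fol_dom k p &
           exists c : C, v = c *: fol_gen k p].

(* M(F, H) *)
Definition complex_tangency (H : set (C2 R)) : set (C2 R) :=
  [set p | [/\ H p, regular_at p &
               tangent_line p `<=` complex_tangent_space H p]].

Definition isolated_singularity (p : C2 R) :=
  [/\ D p, ~ regular_at p & \forall q \near p^', regular_at q].

Definition nondegenerate_at (p : C2 R) :=
  exists k : fol_chart F,
    [/\ fol_dom k p, fol_gen k p = 0 & 'J (fol_gen k) p \in unitmx].

Definition siegel_at (p : C2 R) :=
  nondegenerate_at p /\
  exists k : fol_chart F, exists l m : C,
    [/\ fol_dom k p, fol_gen k p = 0,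
        char_poly ('J (fol_gen k) p) = ('X - l%:P) * ('X - m%:P) & l / m < 0].

(* Value at q, on the vector v, of the 1-form z dw - tau w dz. *)
Definition siegel_form (tau : C) (q v : C2 R) : C :=
  q 0 0 * v 0 1 - tau * (q 0 1 * v 0 0).

(* Psi_* F is given by z dw - tau w dz = 0: away from the singular point, the
   tangent lines of F are the kernels of the form pulled back by Psi. *)
Definition siegel_linearizable_at0 :=
  exists (A B : set (C2 R)) (Psi : C2 R -> C2 R) (tau : R),
    [/\ [/\ A 0, A `<=` D, biholomorphic A B Psi & Psi 0 = 0],
        tau < 0 &
        forall p, A p -> p != 0 ->
          tangent_line p =
          [set v | siegel_form tau%:C (Psi p) ('d Psi p v) = 0]].

End Foliation.
End SeveralComplexVariables.

Arguments closed_bidisc : clear implicits.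
Arguments torus2 : clear implicits.

(* Main.v *)
Require Import Defs.
From mathcomp Require Import all_boot all_order all_algebra.
From mathcomp Require Import complex.
From mathcomp Require Import all_classical all_reals all_analysis.
From mathcomp Require Import ring lra zify.
Import Order.TTheory GRing.Theory Num.Theory.
Import numFieldNormedType.Exports.
Local Open Scope classical_set_scope.
Local Open Scope ring_scope.
Local Open Scope complex_scope.

Set Implicit Arguments.
Unset Strict Implicit.
Unset Printing Implicit Defensive.

Local Notation Re := complex.Re.
Local Notation Im := complex.Im.

(** Write points of the source as [p = (z, w)].  The argument
    determines a holomorphic 1-form that annihilates the foliation along [Phi],
    and reads everything off at the origin.

    Tangency.  A vector [X] such that [X] and ['i X] are both tangent to the
    sphere at [q] satisfies [X_0 * conj q_0 + X_1 * conj q_1 = 0]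
    ([complex_tangency_dot]).  On the torus [conj z = 1 / z], so for
    [Phi = sum a_kl z^k w^l], of degree at most [N] in each variable, the
    conjugate of [Phi] is, up to the factor [(z w)^N], the reversed polynomial
    map [P = sum conj a_kl z^(N-k) w^(N-l)].  Hence on the torus
    [P . X(Phi) = 0] for every local generator [X], and
    [P . Phi = r^2 z^N w^N].

    Continuation.  The second identity is polynomial, hence global.  The first
    one propagates from the torus to the origin along the segment from [(1, 1)]
    to [0], chart after chart ([foliation_continuation]).  This rests on the
    identity theorem in one variable ([identity_disc]).  Holomorphy only means
    that the derivative exists at each point, so the identity theorem is proved
    from Goursat's theorem and the Cauchy integral over a square: if [f] has
    zeros accumulating at [0], all the coefficients in the expansion of its
    Cauchy integral vanish, and [f = 0] on the inscribed disc.

    Linearity ([nonlinear_impossible]).  Let [d] be the total degree of [Phi] and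
    suppose [d > 1].  The lowest homogeneous part [Q] of [P] comes from the top
    part of [Phi].  With [L] the derivative of [Phi] and [A] that of [X] at the
    origin, the lowest order terms of the two identities are [Q(v) . (v L) = 0]
    and [Q(v) . (v L A) = 0]; the right-hand side [r^2 z^N w^N] does not
    contribute because [d > 1].  As [Q] is not zero, [v L] and [v L A] are
    parallel for every [v], so [A] is a scalar matrix and the ratio of its
    eigenvalues cannot be negative.

    Linearization ([linear_siegel_linearizable]).  Now [Phi p = z a + w b], and
    the rows [a] and [b] are orthogonal because [|Phi| = r] on the torus.  The
    same continuation, applied to [w conj a + z conj b], shows that the linear
    coordinates given by the inverse of [Phi] map the foliation to
    [z dw - tau w dz = 0], where [tau = - |a|^2 / |b|^2]. *)

(** * Integrals of complex-valued functions on a segment *)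

Section ComplexNumbers.
Variable R : realType.
Local Notation C := (Cplx R).

Lemma Re_le_norm (z : C) (M : R) : `|z| <= M%:C -> `|Re z| <= M.
Proof. by move=> h; rewrite -lecR (le_trans (normc_ge_Re z)). Qed.

Lemma normc_ge_Im (z : C) : `|Im z|%:C <= `|z|.
Proof.
by case: z => x y; rewrite normc_def /= lecR -sqrtr_sqr ler_wsqrtr // lerDr sqr_ge0.
Qed.

Lemma Im_le_norm (z : C) (M : R) : `|z| <= M%:C -> `|Im z| <= M.
Proof. by move=> h; rewrite -lecR (le_trans (normc_ge_Im z)). Qed.

Lemma norm_le_ReIm (z : C) : `|z| <= (`|Re z| + `|Im z|)%:C.
Proof.
have -> : z = (Re z)%:C + 'i * (Im z)%:C by rewrite -complexE.
rewrite (le_trans (ler_normD _ _))// normrM.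
have -> : `|('i : C)| = 1 by rewrite normc_def /= expr0n add0r expr1n sqrtr1.
rewrite mul1r !normc_def /= !expr0n /= !addr0 !sqrtr_sqr.
by rewrite !(mul0r, mulr0, mul1r, addr0, add0r, subr0, subrr) -rmorphD.
Qed.

Lemma norm_real (x : R) : `|x%:C| = (`|x|)%:C.
Proof. by rewrite normc_def /= expr0n addr0 sqrtr_sqr. Qed.

Lemma continuous_Re : continuous (fun z : C => Re z).
Proof.
move=> z; apply/(@cvgrPdist_lt _ _ _ (nbhs z)) => e e0.
apply/nbhs_ballP; exists (e%:C : C) => [|y zy] /=; first by rewrite ltcR.
rewrite -ltcR; apply: le_lt_trans zy.
have := normc_ge_Re (z - y).
by case: (z) (y) => ? ? [? ?].
Qed.

Lemma continuous_Im : continuous (fun z : C => Im z).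
Proof.
move=> z; apply/(@cvgrPdist_lt _ _ _ (nbhs z)) => e e0.
apply/nbhs_ballP; exists (e%:C : C) => [|y zy] /=; first by rewrite ltcR.
rewrite -ltcR; apply: le_lt_trans zy.
have := normc_ge_Im (z - y).
by case: (z) (y) => ? ? [? ?].
Qed.

Lemma continuous_real : continuous (fun x : R => x%:C : C).
Proof.
move=> z; apply/(@cvgrPdist_lt _ _ _ (nbhs z)) => e e0.
have e1 : e = (Re e)%:C by case: e e0 => a b; rewrite ltcE /= => /andP[/eqP -> ].
apply/nbhs_ballP; exists (Re e) => [|y zy] /=; first by rewrite -ltcR -e1.
by rewrite -rmorphB norm_real e1 ltcR.
Qed.

End ComplexNumbers.
Arguments continuous_Re {R}.
Arguments continuous_Im {R}.
Arguments continuous_real {R}.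

Section Integral.
Variable R : realType.
Local Notation C := (Cplx R).
Local Notation mu := (@lebesgue_measure R).

(** Continuity on the closed segment as a function on the whole line, which
    avoids the subspace topology. *)
Definition cont_on (a b : R) (u : R -> C) :=
  forall x, a <= x <= b -> {for x, continuous u}.

(** Integral over [[a, b]] of a complex-valued function, taken separately on
    real and imaginary parts; it is meant for [a <= b]. *)
Definition cint (a b : R) (u : R -> C) : C :=
  (\int[mu]_(x in `[a, b]) Re (u x)) +i* (\int[mu]_(x in `[a, b]) Im (u x)).

Lemma integrable_cont (a b : R) (u : R -> R) :
  (forall x, a <= x <= b -> {for x, continuous u}) ->
  mu.-integrable `[a, b] (EFin \o u).
Proof.
move=> hu; apply: continuous_compact_integrable; first exact: segment_compact.
apply: continuous_in_subspaceT => x; rewrite inE /= in_itv /=; exact: hu.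
Qed.

Lemma integrable_Re (a b : R) (u : R -> C) : cont_on a b u ->
  mu.-integrable `[a, b] (EFin \o (fun x => Re (u x))).
Proof.
move=> hu; apply: integrable_cont => x xab.
by apply: continuous_comp; [exact: hu|exact: continuous_Re].
Qed.

Lemma integrable_Im (a b : R) (u : R -> C) : cont_on a b u ->
  mu.-integrable `[a, b] (EFin \o (fun x => Im (u x))).
Proof.
move=> hu; apply: integrable_cont => x xab.
by apply: continuous_comp; [exact: hu|exact: continuous_Im].
Qed.

Lemma eq_cint (a b : R) (u v : R -> C) :
  (forall x, a <= x <= b -> u x = v x) -> cint a b u = cint a b v.
Proof.
by move=> uv; congr (_ +i* _); apply: eq_Rintegral => x;
  rewrite inE /= in_itv /= => /uv ->.
Qed.

Lemma cintD (a b : R) (u v : R -> C) : cont_on a b u -> cont_on a b v ->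
  cint a b (fun x => u x + v x) = cint a b u + cint a b v.
Proof.
move=> hu hv; rewrite /cint; simpc.
congr (_ +i* _); rewrite -RintegralD //; try exact: integrable_Re;
  try exact: integrable_Im;
by apply: eq_Rintegral => x _; case: (u x) (v x) => ? ? [? ?].
Qed.

Lemma cintZ (a b : R) (k : C) (u : R -> C) : cont_on a b u ->
  cint a b (fun x => k * u x) = k * cint a b u.
Proof.
move=> hu; case: k => k l; rewrite /cint; simpc.
have hR := integrable_Re hu; have hI := integrable_Im hu.
have mI : measurable `[a, b] by [].
congr (_ +i* _).
  rewrite -!RintegralZl// -RintegralB //.
  - by apply: eq_Rintegral => x _; case: (u x) => ? ?.
  - by apply: eq_integrable (integrableZl _ k hR) => //.
  - by apply: eq_integrable (integrableZl _ l hI) => //.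
rewrite -!RintegralZl// -RintegralD //.
- by apply: eq_Rintegral => x _; case: (u x) => ? ?.
- by apply: eq_integrable (integrableZl _ k hI) => //.
- by apply: eq_integrable (integrableZl _ l hR) => //.
Qed.

Lemma cint_split (a c b : R) (u : R -> C) : a <= c -> c <= b ->
  cont_on a b u -> cint a b u = cint a c u + cint c b u.
Proof.
move=> ac cb hu; rewrite /cint; simpc.
have hR := integrable_Re hu; have hI := integrable_Im hu.
have sub : `]c, b] `<=` `[a, b].
  move=> x /=; rewrite !in_itv /= => /andP[/ltW cx ->]; rewrite andbT.
  exact: le_trans cx.
congr (_ +i* _); apply/eqP; rewrite addrC -subr_eq; apply/eqP.
  rewrite Rintegral_itvB ?bnd_simp // Rintegral_itv_obnd_cbnd //.
  exact: integrableS hR.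
rewrite Rintegral_itvB ?bnd_simp // Rintegral_itv_obnd_cbnd //.
exact: integrableS hI.
Qed.

Lemma fine_mu_itv (a b : R) : a <= b -> fine (mu `[a, b]) = b - a.
Proof.
rewrite lebesgue_measure_itv /= lte_fin le_eqVlt => /orP[/eqP ->|->] //.
by rewrite ltxx subrr.
Qed.

Lemma cint_cst (a b : R) (k : C) : a <= b -> cint a b (fun=> k) = k * (b - a)%:C.
Proof.
move=> ab; case: k => k l; rewrite /cint; simpc.
by rewrite !Rintegral_cst //= fine_mu_itv.
Qed.

(** The constant 2 comes from estimating real and imaginary parts separately; a
    sharp constant is not needed. *)
Lemma cint_le (a b M : R) (u : R -> C) : a <= b -> cont_on a b u ->
  (forall x, a <= x <= b -> `|u x| <= M%:C) ->
  `|cint a b u| <= (2 * M * (b - a))%:C.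
Proof.
move=> ab hu hM.
apply: le_trans (norm_le_ReIm _) _; rewrite lecR /cint /=.
have key (g : R -> R) : mu.-integrable `[a, b] (EFin \o g) ->
    (forall x, a <= x <= b -> `|g x| <= M) ->
    `|\int[mu]_(x in `[a, b]) g x| <= M * (b - a).
  move=> ig gM; apply: le_trans (le_normr_Rintegral _ ig) _ => //.
  have -> : M * (b - a) = \int[mu]_(x in `[a, b]) M.
    by rewrite Rintegral_cst //= fine_mu_itv.
  apply: le_Rintegral => //.
  - exact: integrable_norm ig.
  - by apply: integrable_cont => x _; exact: cvg_cst.
rewrite -mulrA mulr_natl mulr2n lerD //.
  by apply: key => [|x /hM /Re_le_norm//]; exact: integrable_Re.
by apply: key => [|x /hM /Im_le_norm//]; exact: integrable_Im.
Qed.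

Lemma cint_id (a b : R) : a <= b ->
  cint a b (fun x => x%:C) = ((b ^+ 2 - a ^+ 2) / 2)%:C.
Proof.
rewrite le_eqVlt => /orP[/eqP ->|ab].
  by rewrite subrr mul0r /cint set_itv1 !Rintegral_set1.
rewrite /cint /=; congr (_ +i* _); last by rewrite Rintegral_cst // mul0r.
have dF (x : R) : is_derive x 1 (fun x : R => 2^-1 *: (x ^+ 2)) x.
  by apply: is_derive_eq; rewrite /GRing.scale /=; lra.
have cF (x : R) : {for x, continuous (fun x : R => 2^-1 *: (x ^+ 2))}.
  by apply: differentiable_continuous; apply/derivable1_diffP; exact: ex_derive.
rewrite /Rintegral.
have -> : (\int[mu]_(x in `[a, b]) x%:E = (2^-1 *: (b ^+ 2))%:E - (2^-1 *: (a ^+ 2))%:E)%E.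
  apply: (@continuous_FTC2 _ (fun x => x) (fun x : R => 2^-1 *: (x ^+ 2)) a b) => //.
- by apply: continuous_subspaceT => x; exact: cvg_id.
- split => [x _| |]; first exact: ex_derive.
  + by apply: cvg_at_right_filter; exact: cF.
  + by apply: cvg_at_left_filter; exact: cF.
- by move=> x _; rewrite derive1E; apply: derive_val.
- by rewrite /GRing.scale /=; lra.
Qed.

Lemma cint_Im_gt0 (a b m : R) (u : R -> C) : a < b -> 0 < m -> cont_on a b u ->
  (forall x, a <= x <= b -> m <= Im (u x)) -> 0 < Im (cint a b u).
Proof.
move=> ab m0 hu hm; rewrite /cint /=.
apply: (@lt_le_trans _ _ (\int[mu]_(x in `[a, b]) m)).
  rewrite Rintegral_cst //= fine_mu_itv ?ltW//.
  by rewrite mulr_gt0 // subr_gt0.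
apply: le_Rintegral => //.
- by apply: integrable_cont => x _; exact: cvg_cst.
- exact: integrable_Im.
Qed.

End Integral.

(** * Contour integrals over rectangles *)

Section Contour.
Variable R : realType.
Local Notation C := (Cplx R).

Lemma continuous_hor (y : R) : continuous (fun x : R => (x +i* y : C)).
Proof.
move=> z; apply/(@cvgrPdist_lt _ _ _ (nbhs z)) => e e0.
have e1 : e = (Re e)%:C by case: e e0 => a b; rewrite ltcE /= => /andP[/eqP -> ].
apply/nbhs_ballP; exists (Re e) => [|x zx] /=; first by rewrite -ltcR -e1.
have -> : (z +i* y - (x +i* y) : C) = (z - x)%:C.
  by apply/eqP; rewrite eq_complex /= subrr !eqxx.
by rewrite norm_real e1 ltcR.
Qed.

Lemma continuous_ver (x : R) : continuous (fun y : R => (x +i* y : C)).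
Proof.
move=> z; apply/(@cvgrPdist_lt _ _ _ (nbhs z)) => e e0.
have e1 : e = (Re e)%:C by case: e e0 => a b; rewrite ltcE /= => /andP[/eqP -> ].
apply/nbhs_ballP; exists (Re e) => [|y zy] /=; first by rewrite -ltcR -e1.
have -> : (x +i* z - (x +i* y) : C) = 'i * (z - y)%:C.
  by apply/eqP; rewrite eq_complex /= !(mul0r, mul1r, mulr0) subrr subr0 add0r !eqxx.
rewrite normrM norm_real normc_def /= expr0n add0r expr1n sqrtr1 mul1r.
by rewrite e1 ltcR.
Qed.

Lemma complexCE (x y : R) : (x +i* y : C) = x%:C + 'i * y%:C.
Proof. by rewrite [LHS]complexE. Qed.

Lemma norm_i : `|('i : C)| = 1.
Proof. by rewrite normc_def /= expr0n add0r expr1n sqrtr1. Qed.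

(** The modulus as an element of [R]; the norm [`|z|] itself is an element of
    [C]. *)
Definition nm (z : C) : R := Re `|z|.

Lemma nmE z : `|z| = (nm z)%:C.
Proof. by rewrite /nm normc_def. Qed.

Lemma nm_ge0 z : 0 <= nm z.
Proof. by rewrite -lecR -nmE normr_ge0. Qed.

Lemma nmD x y : nm (x + y) <= nm x + nm y.
Proof. by rewrite -lecR rmorphD /= -!nmE ler_normD. Qed.

Lemma nm_eq0 z : (nm z == 0) = (z == 0).
Proof. by rewrite -(normr_eq0 z) nmE eq_complex /= eqxx andbT. Qed.

(** The boundary of the rectangle [[x0, x1] x [y0, y1]]. *)
Definition on_boundary (x0 x1 y0 y1 : R) (z : C) :=
  [/\ x0 <= Re z <= x1, y0 <= Im z <= y1 &
      [\/ Re z = x0, Re z = x1, Im z = y0 | Im z = y1]].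

(** Integral of [g dz] along the boundary of the rectangle [[x0, x1] x [y0,
    y1]], anticlockwise. *)
Definition rect_int (g : C -> C) (x0 x1 y0 y1 : R) : C :=
  cint x0 x1 (fun x => g (x +i* y0)) - cint x0 x1 (fun x => g (x +i* y1)) +
  'i * (cint y0 y1 (fun y => g (x1 +i* y)) - cint y0 y1 (fun y => g (x0 +i* y))).

Definition boundary_cont x0 x1 y0 y1 (g : C -> C) :=
  forall z, on_boundary x0 x1 y0 y1 z -> {for z, continuous g}.

Section OneRect.
Variables x0 x1 y0 y1 : R.
Hypotheses (x01 : x0 <= x1) (y01 : y0 <= y1).
Local Notation bc := (boundary_cont x0 x1 y0 y1).

Lemma cont_hor (g : C -> C) y : y = y0 \/ y = y1 -> bc g ->
  cont_on x0 x1 (fun x => g (x +i* y)).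
Proof.
move=> hy hg x xx.
apply: (@continuous_comp _ _ _ (fun x : R => (x +i* y : C)) g).
  exact: continuous_hor.
by apply: hg; split => //=; case: hy => ->; rewrite ?lexx ?y01 //;
  [constructor 3|constructor 4].
Qed.

Lemma cont_ver (g : C -> C) x : x = x0 \/ x = x1 -> bc g ->
  cont_on y0 y1 (fun y => g (x +i* y)).
Proof.
move=> hx hg y yy.
apply: (@continuous_comp _ _ _ (fun y : R => (x +i* y : C)) g).
  exact: continuous_ver.
by apply: hg; split => //=; case: hx => ->; rewrite ?lexx ?x01 //;
  [constructor 1|constructor 2].
Qed.

Lemma eq_rect_int (f g : C -> C) :
  (forall z, on_boundary x0 x1 y0 y1 z -> f z = g z) ->
  rect_int f x0 x1 y0 y1 = rect_int g x0 x1 y0 y1.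
Proof.
move=> fg; rewrite /rect_int.
by congr (_ - _ + _ * (_ - _)); apply: eq_cint => t tt; apply: fg; split => //=;
  rewrite ?lexx ?x01 ?y01 //;
  [constructor 3|constructor 4|constructor 2|constructor 1].
Qed.

Lemma rect_intD (f g : C -> C) : bc f -> bc g ->
  rect_int (fun z => f z + g z) x0 x1 y0 y1 =
  rect_int f x0 x1 y0 y1 + rect_int g x0 x1 y0 y1.
Proof.
move=> hf hg; rewrite /rect_int !cintD;
  try (by apply: cont_hor => //; tauto); try (by apply: cont_ver => //; tauto).
ring.
Qed.

Lemma rect_intZ (k : C) (g : C -> C) : bc g ->
  rect_int (fun z => k * g z) x0 x1 y0 y1 = k * rect_int g x0 x1 y0 y1.
Proof.
move=> hg; rewrite /rect_int !cintZ;
  try (by apply: cont_hor => //; tauto); try (by apply: cont_ver => //; tauto).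
ring.
Qed.

Lemma rect_int_le (M : R) (g : C -> C) : bc g ->
  (forall z, on_boundary x0 x1 y0 y1 z -> nm (g z) <= M) ->
  nm (rect_int g x0 x1 y0 y1) <= 4 * M * ((x1 - x0) + (y1 - y0)).
Proof.
move=> hg hM; rewrite -lecR -nmE /rect_int.
have hh y : y = y0 \/ y = y1 -> `|cint x0 x1 (fun x => g (x +i* y))| <=
    (2 * M * (x1 - x0))%:C.
  move=> hy; apply: cint_le => //; first exact: cont_hor.
  move=> x xx; rewrite nmE lecR; apply: hM; split => //=.
    by case: hy => ->; rewrite ?lexx ?y01.
  by case: hy => ->; [constructor 3|constructor 4].
have hv x : x = x0 \/ x = x1 -> `|cint y0 y1 (fun y => g (x +i* y))| <=
    (2 * M * (y1 - y0))%:C.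
  move=> hx; apply: cint_le => //; first exact: cont_ver.
  move=> y yy; rewrite nmE lecR; apply: hM; split => //=.
    by case: hx => ->; rewrite ?lexx ?x01.
  by case: hx => ->; [constructor 1|constructor 2].
have -> : (4 * M * (x1 - x0 + (y1 - y0)))%:C =
  ((2 * M * (x1 - x0))%:C + (2 * M * (x1 - x0))%:C +
  ((2 * M * (y1 - y0))%:C + (2 * M * (y1 - y0))%:C) : C).
  by rewrite -!rmorphD; congr (_%:C); ring.
apply: le_trans (ler_normD _ _) _; rewrite normrM norm_i mul1r.
apply: lerD; apply: le_trans (ler_normB _ _) _; apply: lerD.
- exact: hh (or_introl erefl).
- exact: hh (or_intror erefl).
- exact: hv (or_intror erefl).
- exact: hv (or_introl erefl).
Qed.

Lemma rect_int_affine (a b : C) : rect_int (fun z => a + b * z) x0 x1 y0 y1 = 0.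
Proof.
have cid (u v : R) : cont_on u v (fun x : R => x%:C : C).
  by move=> x _; exact: continuous_real.
have ccst (u v : R) (k : C) : cont_on u v (fun x : R => k).
  by move=> x _; exact: cvg_cst.
have cM (u v : R) (k : C) : cont_on u v (fun x : R => k * x%:C : C).
  by move=> x _; apply: cvgM; [exact: cvg_cst|exact: continuous_real].
have H (y : R) : cint x0 x1 (fun x => a + b * (x +i* y)) =
    (a + b * 'i * y%:C) * (x1 - x0)%:C + b * ((x1 ^+ 2 - x0 ^+ 2) / 2)%:C.
  rewrite -cint_cst // -cint_id // -cintZ // -cintD //.
  by apply: eq_cint => x _; rewrite complexCE; ring.
have V (x : R) : cint y0 y1 (fun y => a + b * (x +i* y)) =
    (a + b * x%:C) * (y1 - y0)%:C + (b * 'i) * ((y1 ^+ 2 - y0 ^+ 2) / 2)%:C.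
  rewrite -cint_cst // -cint_id // -cintZ // -cintD //.
  by apply: eq_cint => y _; rewrite complexCE; ring.
rewrite /rect_int !H !V !(rmorphB, rmorphM, rmorphXn) /=.
have i2 : 'i * 'i = -1 :> C by simpc.
by ring: i2.
Qed.

End OneRect.

Lemma rect_split_x (g : C -> C) x0 x x1 y0 y1 : x0 <= x -> x <= x1 -> y0 <= y1 ->
  boundary_cont x0 x1 y0 y1 g ->
  rect_int g x0 x1 y0 y1 = rect_int g x0 x y0 y1 + rect_int g x x1 y0 y1.
Proof.
move=> h0 h1 hy hg; rewrite /rect_int.
have c0 := cont_hor hy (or_introl erefl) hg.
have c1 := cont_hor hy (or_intror erefl) hg.
by rewrite (cint_split h0 h1 c0) (cint_split h0 h1 c1); ring.
Qed.

Lemma rect_split_y (g : C -> C) x0 x1 y0 y y1 : y0 <= y -> y <= y1 -> x0 <= x1 ->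
  boundary_cont x0 x1 y0 y1 g ->
  rect_int g x0 x1 y0 y1 = rect_int g x0 x1 y0 y + rect_int g x0 x1 y y1.
Proof.
move=> h0 h1 hx hg; rewrite /rect_int.
have c0 := cont_ver hx (or_introl erefl) hg.
have c1 := cont_ver hx (or_intror erefl) hg.
by rewrite (cint_split h0 h1 c0) (cint_split h0 h1 c1); ring.
Qed.

End Contour.

(** * Goursat's theorem *)

Section Goursat.
Variable R : realType.
Local Notation C := (Cplx R).

Lemma pos_complexE (e : C) : 0 < e -> exists2 d : R, 0 < d & e = d%:C.
Proof.
by case: e => a b; rewrite ltcE /= => /andP[/eqP -> a0]; exists a.
Qed.

(** Complex differentiability as an estimate in [R]; the affine part has zero
    contour integral. *)
Lemma derivable_expansion (g : C -> C) (p : C) : derivable g p 1 ->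
  exists L : C, forall e : R, 0 < e -> exists2 d : R, 0 < d &
    forall z, nm (z - p) < d -> nm (g z - (g p + L * (z - p))) <= e * nm (z - p).
Proof.
move=> /cvg_ex [L hL]; exists L => e e0.
have eC : 0 < (e%:C : C) by rewrite ltcR.
move/cvgrPdist_le : hL => /(_ _ eC) /nbhs_ballP [d' d0' hd].
have [d d0 dE] := pos_complexE d0'.
exists d => // z zd.
have [->|zp] := eqVneq z p.
  by rewrite subrr mulr0 addr0 subrr /nm normr0 /= mulr0.
have h0 : z - p != 0 by rewrite subr_eq0.
have := hd (z - p); rewrite -ball_normE /= sub0r normrN.
rewrite dE nmE ltcR zd h0 /GRing.scale /= mulr1 subrK => /(_ isT isT).
move=> /(ler_wpM2r (normr_ge0 (z - p))).
have E : g z - (g p + L * (z - p)) = - ((L - (z - p)^-1 * (g z - g p)) * (z - p)).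
  by field.
by rewrite -normrM -lecR rmorphM /= -!nmE E normrN.
Qed.

Lemma nested_intervals (a d : nat -> R) : (forall n, a n <= a n.+1) ->
  (forall n, a n.+1 + d n.+1 <= a n + d n) -> (forall n, 0 <= d n) ->
  exists x, forall n, a n <= x <= a n + d n.
Proof.
move=> ha hd d0.
have mono m n : (m <= n)%N -> a m <= a n.
  elim: n => [|n IH]; first by rewrite leqn0 => /eqP ->.
  by rewrite leq_eqVlt ltnS => /orP[/eqP ->//|/IH /le_trans]; apply.
have mono' m n : (m <= n)%N -> a n + d n <= a m + d m.
  elim: n => [|n IH]; first by rewrite leqn0 => /eqP ->.
  by rewrite leq_eqVlt ltnS => /orP[/eqP ->//|/IH]; apply: le_trans.
have ub n : ubound (range a) (a n + d n).
  move=> _ [m _ <-]; apply: le_trans (mono m (maxn m n) (leq_maxl _ _)) _.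
  by apply: le_trans (mono' n (maxn m n) (leq_maxr _ _)); rewrite lerDl.
exists (sup (range a)) => n; apply/andP; split.
  by apply: ub_le_sup; [exists (a n + d n)|exists n].
by apply: ge_sup; [exists (a 0%N); exists 0%N|].
Qed.

Lemma nm_le_ReIm (z : C) : nm z <= `|Re z| + `|Im z|.
Proof. by rewrite -lecR -nmE norm_le_ReIm. Qed.

Lemma nmN (z : C) : nm (- z) = nm z.
Proof. by rewrite /nm normrN. Qed.

Lemma nmM (y z : C) : nm (y * z) = nm y * nm z.
Proof.
by apply: (@complexI R); rewrite rmorphM /= -!nmE normrM.
Qed.

Lemma derivable_continuous (g : C -> C) (z : C) :
  derivable g z 1 -> {for z, continuous g}.
Proof. by move=> /derivable1_diffP; exact: differentiable_continuous. Qed.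

Lemma affine_continuous (a b : C) : continuous (fun z : C => a + b * z).
Proof.
move=> z; apply: (@cvgD _ _ _ (nbhs z) _ (fun=> a) (fun z => b * z)).
  exact: cvg_cst.
by apply: (@cvgM _ _ (nbhs z) _ (fun=> b) id); [exact: cvg_cst|exact: cvg_id].
Qed.

(** The closed rectangle. *)
Definition in_rect (x0 x1 y0 y1 : R) (z : C) :=
  x0 <= Re z <= x1 /\ y0 <= Im z <= y1.

(** Bisection of both sides: one of the quarters carries at least a quarter of
    the integral. *)
Lemma rect_quarter (g : C -> C) x y (s t : R) : 0 <= s -> 0 <= t ->
  (forall z, in_rect x (x + 2 * s) y (y + 2 * t) z -> {for z, continuous g}) ->
  exists x' y', [/\ x' = x \/ x' = x + s, y' = y \/ y' = y + t &
    nm (rect_int g x (x + 2 * s) y (y + 2 * t)) <=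
      4 * nm (rect_int g x' (x' + s) y' (y' + t))].
Proof.
move=> s0 t0 hg.
have bc u v u' v' : x <= u -> v <= x + 2 * s -> y <= u' -> v' <= y + 2 * t ->
    boundary_cont u v u' v' g.
  move=> h1 h2 h3 h4 z [/andP[h5 h6] /andP[h7 h8] _]; apply: hg; split;
  apply/andP; split; lra.
have e : rect_int g x (x + 2 * s) y (y + 2 * t) =
  (rect_int g x (x + s) y (y + t) + rect_int g x (x + s) (y + t) (y + t + t)) +
  (rect_int g (x + s) (x + s + s) y (y + t) +
   rect_int g (x + s) (x + s + s) (y + t) (y + t + t)).
  have es : x + 2 * s = x + s + s by ring.
  have et : y + 2 * t = y + t + t by ring.
  have x1 : x <= x + s by lra.
  have x2 : x + s <= x + s + s by lra.
  have y1 : y <= y + t by lra.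
  have y2 : y + t <= y + t + t by lra.
  rewrite es et (rect_split_x x1 x2); last 2 first.
  - lra.
  - by apply: bc; lra.
  by rewrite !(rect_split_y y1 y2) //; apply: bc; lra.
set a := rect_int g x (x + s) y (y + t) in e *.
set b := rect_int g x (x + s) (y + t) (y + t + t) in e *.
set c := rect_int g (x + s) (x + s + s) y (y + t) in e *.
set d := rect_int g (x + s) (x + s + s) (y + t) (y + t + t) in e *.
have le : nm (a + b + (c + d)) <= nm a + nm b + (nm c + nm d).
  by apply: le_trans (nmD _ _) _; apply: lerD; exact: nmD.
rewrite e.
case: (leP (nm (a + b + (c + d))) (4 * nm a)) => ha.
  by exists x, y; split=> //; left.
case: (leP (nm (a + b + (c + d))) (4 * nm b)) => hb.
  by exists x, (y + t); split=> //; [left|right].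
case: (leP (nm (a + b + (c + d))) (4 * nm c)) => hc.
  by exists (x + s), y; split=> //; [right|left].
case: (leP (nm (a + b + (c + d))) (4 * nm d)) => hd.
  by exists (x + s), (y + t); split=> //; right.
have aux (w p q u v : R) : w <= p + q + (u + v) -> 4 * p < w -> 4 * q < w ->
    4 * u < w -> 4 * v < w -> False by clear; lra.
by case: (aux _ _ _ _ _ le ha hb hc hd).
Qed.

Lemma exists_pow2 (a d : R) : 0 < d -> exists n, a / 2 ^+ n < d.
Proof.
move=> d0; have [n hn] : exists n, a / d < n%:R.
  by exists (Num.bound `|a / d|); apply: le_lt_trans (ler_norm _) (archi_boundP _).
exists n; rewrite ltr_pdivrMr ?exprn_gt0 // -ltr_pdivrMl //.
apply: lt_trans (_ : n%:R < _); first by rewrite mulrC.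
by rewrite -natrX ltr_nat ltn_expl.
Qed.

(** Existence of the derivative at every point of the closed rectangle suffices;
    no continuity of the derivative is assumed. *)
Theorem goursat (g : C -> C) x0 x1 y0 y1 : x0 <= x1 -> y0 <= y1 ->
  (forall z, in_rect x0 x1 y0 y1 z -> derivable g z 1) ->
  rect_int g x0 x1 y0 y1 = 0.
Proof.
move=> hx hy hg.
pose w n := (x1 - x0) / 2 ^+ n; pose h n := (y1 - y0) / 2 ^+ n.
have w0 n : 0 <= w n by rewrite divr_ge0 ?subr_ge0 ?exprn_ge0.
have h0 n : 0 <= h n by rewrite divr_ge0 ?subr_ge0 ?exprn_ge0.
have w2 n : w n = 2 * w n.+1 by rewrite /w exprS; field; rewrite expf_neq0.
have h2 n : h n = 2 * h n.+1 by rewrite /h exprS; field; rewrite expf_neq0.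
pose I n (p : R * R) := rect_int g p.1 (p.1 + w n) p.2 (p.2 + h n).
pose inside n (p : R * R) :=
  [/\ x0 <= p.1, p.1 + w n <= x1, y0 <= p.2 & p.2 + h n <= y1].
pose next n (p q : R * R) := [/\ q.1 = p.1 \/ q.1 = p.1 + w n.+1,
    q.2 = p.2 \/ q.2 = p.2 + h n.+1 & nm (I n p) <= 4 * nm (I n.+1 q)].
have nextP n p : exists q, inside n p -> next n p q.
  have [[h1 h3 h4 h5]|ni] := pselect (inside n p); last by exists p.
  have [|x' [y' [hx' hy' hI]]] := @rect_quarter g p.1 p.2 (w n.+1) (h n.+1) (w0 _) (h0 _).
    rewrite -w2 -h2 => z [/andP[h6 h7] /andP[h8 h9]].
    apply: derivable_continuous; apply: hg.
    by split; apply/andP; split; lra.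
  by exists (x', y') => _; split => //; move: hI; rewrite -w2 -h2.
have [F hF] : {F : nat -> R * R -> R * R & forall n p, inside n p -> next n p (F n p)}.
  pose F n p := sval (cid (nextP n p)).
  by exists F => n p; rewrite /F; case: cid.
pose P := fix P n := if n is m.+1 then F m (P m) else (x0, y0).
have inP n : inside n (P n).
  elim: n => [|n IH]; first by split; rewrite /= ?lexx // /w /h expr0 divr1; lra.
  have [h1 h3 _] := hF _ _ IH; have [h5 h6 h7 h8] := IH.
  rewrite w2 in h6; rewrite h2 in h8; have := w0 n.+1; have := h0 n.+1.
  move=> h9 h10.
  rewrite /inside /=; clear -h1 h3 h5 h6 h7 h8 h9 h10.
  by case: h1 => ->; case: h3 => ->; split; lra.
have nP n : next n (P n) (P n.+1) by apply: hF.
have [px hpx] : exists x, forall n, (P n).1 <= x <= (P n).1 + w n.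
  apply: nested_intervals => // n; have [h1 _ _] := nP n; have := w0 n.+1.
    by case: h1 => ->; lra.
  by rewrite (w2 n); case: h1 => ->; lra.
have [py hpy] : exists x, forall n, (P n).2 <= x <= (P n).2 + h n.
  apply: nested_intervals => // n; have [_ h1 _] := nP n; have := h0 n.+1.
    by case: h1 => ->; lra.
  by rewrite (h2 n); case: h1 => ->; lra.
pose p : C := px +i* py.
have [|L hL] := @derivable_expansion g p.
  apply: hg; have [/andP[h1 h3] /andP[h4 h5]] := (hpx 0%N, hpy 0%N).
  have [h6 h7 h8 h9] := inP 0%N.
  by split; apply/andP; split => /=; lra.
apply/eqP; rewrite -nm_eq0 eq_le nm_ge0 andbT.
set W := x1 - x0 + (y1 - y0).
have W0 : 0 <= W by rewrite /W; lra.
have key e : 0 < e -> nm (rect_int g x0 x1 y0 y1) <= 4 * e * W ^+ 2.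
  move=> e0; have [d d0 hd] := hL _ e0.
  have [n hn] := exists_pow2 W d0.
  (* after m bisections the loss is at most a factor 4 ^ m *)
  have decay m : nm (rect_int g x0 x1 y0 y1) <= 4 ^+ m * nm (I m (P m)).
    elim: m => [|m IH].
      by rewrite /I /= expr0 mul1r /w /h expr0 !divr1 !(addrC _ (_ - _)) !subrK.
    apply: le_trans IH _; rewrite exprSr -mulrA ler_wpM2l ?exprn_ge0//.
    by have [_ _] := nP m.
  have Wn : W / 2 ^+ n = w n + h n by rewrite /W mulrDl.
  have [bx1 bx2] := andP (hpx n); have [by1 by2] := andP (hpy n).
  have near z : in_rect (P n).1 ((P n).1 + w n) (P n).2 ((P n).2 + h n) z ->
      nm (z - p) <= W / 2 ^+ n.
    move=> [/andP[h1 h3] /andP[h4 h5]]; apply: le_trans (nm_le_ReIm _) _.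
    rewrite Wn; case: (z) h1 h3 h4 h5 => u v /= h1 h3 h4 h5.
    clear -h1 h3 h4 h5 bx1 bx2 by1 by2.
    by rewrite lerD // ler_norml; apply/andP; split; lra.
  have hw : (P n).1 <= (P n).1 + w n by rewrite lerDl.
  have hh : (P n).2 <= (P n).2 + h n by rewrite lerDl.
  have gd z : in_rect (P n).1 ((P n).1 + w n) (P n).2 ((P n).2 + h n) z ->
      {for z, continuous g}.
    move=> [/andP[h1 h3] /andP[h4 h5]]; apply: derivable_continuous; apply: hg.
    have [h6 h7 h8 h9] := inP n; clear -h1 h3 h4 h5 h6 h7 h8 h9.
    by split; apply/andP; split; lra.
  pose aff (z : C) := (g p - L * p) + L * z.
  have caff : continuous aff.
    exact: affine_continuous.
  have IE : I n (P n) = rect_int (fun z => g z + (-1) * aff z)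
      (P n).1 ((P n).1 + w n) (P n).2 ((P n).2 + h n).
    rewrite rect_intD //; last 2 first.
    - by move=> z [h1 h3 _]; exact: gd.
    - by move=> z _; apply: (@cvgM _ _ (nbhs z) _ (fun=> -1) aff); [exact: cvg_cst|exact: caff].
    rewrite rect_intZ //; last by move=> z _; exact: caff.
    by rewrite /aff rect_int_affine // mulr0 addr0.
  (* perimeter and oscillation both have size W / 2 ^ n, which compensates 4 ^ n *)
  have : nm (I n (P n)) <= 4 * (e * (W / 2 ^+ n)) * (W / 2 ^+ n).
    rewrite IE [X in _ <= _ * X]Wn.
    have -> : w n + h n = (P n).1 + w n - (P n).1 + ((P n).2 + h n - (P n).2) by ring.
    apply: rect_int_le => //.
      move=> z [h1 h3 _]; apply: (@cvgD _ _ _ (nbhs z) _ g (fun z => -1 * aff z)).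
        exact: gd.
      by apply: (@cvgM _ _ (nbhs z) _ (fun=> -1) aff); [exact: cvg_cst|exact: caff].
    move=> z [h1 h3 _].
    have hz := near z (conj h1 h3).
    have -> : g z + -1 * aff z = g z - (g p + L * (z - p)) by rewrite /aff; ring.
    apply: le_trans (hd _ _) _; first exact: le_lt_trans hn.
    by rewrite ler_wpM2l // ltW.
  move=> hI; apply: le_trans (decay n) _.
  apply: le_trans (_ : 4 ^+ n * (4 * (e * (W / 2 ^+ n)) * (W / 2 ^+ n)) <= _).
    by rewrite ler_wpM2l // exprn_ge0.
  have -> : (4 : R) = 2 * 2 by rewrite -natrM.
  rewrite exprMn le_eqVlt; apply/orP; left; apply/eqP; field.
  by rewrite expf_neq0.
have [W00|Wn0] := eqVneq W 0.
  by have := key 1 ltr01; rewrite W00 expr0n mulr0.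
have Wp : 0 < 4 * W ^+ 2 by rewrite mulr_gt0 // exprn_gt0 // lt_neqAle eq_sym Wn0.
apply/ler_addgt0Pr => e e0; rewrite add0r.
have := key (e / (4 * W ^+ 2)) (divr_gt0 e0 Wp).
by rewrite mulrAC mulrCA divff ?mulr1 // gt_eqF.
Qed.

End Goursat.

(** * Removing a bounded singularity *)

Section PuncturedRectangle.
Variable R : realType.
Local Notation C := (Cplx R).

Lemma continuous_nm : continuous (@nm R).
Proof.
move=> z; apply: (@continuous_comp _ _ _ (fun z : C => `|z|) (fun z : C => Re z)).
  exact: norm_continuous.
exact: continuous_Re.
Qed.

Lemma Re_le_nm (z : C) : `|Re z| <= nm z.
Proof. by apply: Re_le_norm; rewrite nmE. Qed.

Lemma Im_le_nm (z : C) : `|Im z| <= nm z.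
Proof. by apply: Im_le_norm; rewrite nmE. Qed.

Lemma cont_on_bounded (a b : R) (u : R -> C) : a <= b -> cont_on a b u ->
  exists M, forall x, a <= x <= b -> nm (u x) <= M.
Proof.
move=> ab hu; have [c _ hc] : exists2 c, c \in `[a, b] &
    forall t, t \in `[a, b] -> nm (u t) <= nm (u c).
  apply: EVT_max => //; apply: continuous_in_subspaceT => x.
  rewrite inE /= in_itv /= => xab.
  apply: (@continuous_comp _ _ _ u (@nm R)); first exact: hu.
  exact: continuous_nm.
by exists (nm (u c)) => x xab; apply: hc; rewrite in_itv.
Qed.

Lemma boundary_bounded (g : C -> C) x0 x1 y0 y1 : x0 <= x1 -> y0 <= y1 ->
  boundary_cont x0 x1 y0 y1 g ->
  exists M, forall z, on_boundary x0 x1 y0 y1 z -> nm (g z) <= M.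
Proof.
move=> hx hy hg.
have [M1 h1] := cont_on_bounded hx (cont_hor hy (or_introl erefl) hg).
have [M2 h2] := cont_on_bounded hx (cont_hor hy (or_intror erefl) hg).
have [M3 h3] := cont_on_bounded hy (cont_ver hx (or_introl erefl) hg).
have [M4 h4] := cont_on_bounded hy (cont_ver hx (or_intror erefl) hg).
exists (Num.max (Num.max M1 M2) (Num.max M3 M4)) => -[x y] [/= hx' hy' H].
rewrite !le_max; case: H => e; rewrite e in hx' hy' *.
- by rewrite h3 // !orbT.
- by rewrite h4 // !orbT.
- by rewrite h1.
- by rewrite h2 // orbT.
Qed.

(** Four rectangles around a small square centred at [a] contribute nothing, and
    the square contributes at most a constant times its side. *)
Lemma rect_int_punctured (g : C -> C) (a : C) x0 x1 y0 y1 :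
  x0 < Re a < x1 -> y0 < Im a < y1 ->
  (forall z, in_rect x0 x1 y0 y1 z -> z != a -> derivable g z 1) ->
  (exists K d, 0 < d /\ forall z, z != a -> nm (z - a) < d -> nm (g z) <= K) ->
  rect_int g x0 x1 y0 y1 = 0.
Proof.
move=> /andP[xa ax] /andP[ya ay] hg [K [d [d0 hK]]].
set r := Re a in xa ax *; set t := Im a in ya ay *.
have neq z : Re z != r \/ Im z != t -> z != a.
  by case=> h; apply: contra_neq h => ->.
have gc z : in_rect x0 x1 y0 y1 z -> z != a -> {for z, continuous g}.
  by move=> h1 h2; apply: derivable_continuous; exact: hg.
apply/eqP; rewrite -nm_eq0 eq_le nm_ge0 andbT.
apply/ler_addgt0Pr => e0 e00; rewrite add0r.
pose e := Num.min (Num.min (Num.min (r - x0) (x1 - r)) (Num.min (t - y0) (y1 - t)))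
  (Num.min (d / 4) (e0 / (16 * (`|K| + 1)))).
have K0 : 0 < `|K| + 1 by rewrite ltr_wpDl.
have ee : [/\ e <= r - x0, e <= x1 - r, e <= t - y0 & e <= y1 - t].
  by split; rewrite /e !ge_min lexx ?orbT.
have ed : e <= d / 4 by rewrite /e !ge_min lexx ?orbT.
have ee0 : e <= e0 / (16 * (`|K| + 1)) by rewrite /e !ge_min lexx ?orbT.
have ep : 0 < e by rewrite /e !lt_min !subr_gt0 xa ax ya ay /= !divr_gt0 // mulr_gt0.
clearbody e; case: ee => e1 e2 e3 e4.
have a1 : x0 <= r - e by clear -e1; lra.
have a2 : r - e < r by clear -ep; lra.
have a3 : r < r + e by clear -ep; lra.
have a4 : r + e <= x1 by clear -e2; lra.
have b1 : y0 <= t - e by clear -e3; lra.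
have b2 : t - e < t by clear -ep; lra.
have b3 : t < t + e by clear -ep; lra.
have b4 : t + e <= y1 by clear -e4; lra.
have a5 := ltW (lt_trans a2 a3); have b5 := ltW (lt_trans b2 b3).
have a6 := ltW (lt_le_trans a3 a4); have b6 := ltW (lt_le_trans b3 b4).
have a7 := le_trans a5 a4; have b7 := le_trans b5 b4.
have a8 := le_trans a1 a7; have b8 := le_trans b1 b7.
have a9 := le_trans a1 a5; have b9 := le_trans b1 b5.
(* the splitting lines avoid a *)
have bc u v u' v' : x0 <= u -> v <= x1 -> y0 <= u' -> v' <= y1 ->
    u < r -> r < v -> u' < t -> t < v' -> boundary_cont u v u' v' g.
  move=> h1 h2 h3 h4 n1 n2 n3 n4 z [/andP[h5 h6] /andP[h7 h8] H]; apply: gc.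
    by split; rewrite ?(le_trans h1 h5) ?(le_trans h6 h2) ?(le_trans h3 h7) ?(le_trans h8 h4).
  apply: neq; case: H => ->; [left|left|right|right].
  - by rewrite lt_eqF.
  - by rewrite gt_eqF.
  - by rewrite lt_eqF.
  - by rewrite gt_eqF.
have gr u v u' v' : x0 <= u -> v <= x1 -> y0 <= u' -> v' <= y1 -> u <= v -> u' <= v' ->
    [\/ v < r, r < u, v' < t | t < u'] -> rect_int g u v u' v' = 0.
  move=> h1 h2 h3 h4 h5 h6 H; apply: goursat => // z [/andP[h7 h8] /andP[h9 h10]].
  apply: hg.
    by split; rewrite ?(le_trans h1 h7) ?(le_trans h8 h2) ?(le_trans h3 h9) ?(le_trans h10 h4).
  apply: neq; case: H => H; [left|left|right|right].
  - by rewrite lt_eqF // (le_lt_trans h8).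
  - by rewrite gt_eqF // (lt_le_trans H).
  - by rewrite lt_eqF // (le_lt_trans h10).
  - by rewrite gt_eqF // (lt_le_trans H).
have x0x1 := lexx x0; have x1x1 := lexx x1; have y0y0 := lexx y0; have y1y1 := lexx y1.
have y01 := le_trans b1 b7.
rewrite (rect_split_x a1 a7 y01 (bc _ _ _ _ x0x1 x1x1 y0y0 y1y1 xa ax ya ay)).
rewrite (rect_split_x a5 a4 y01 (bc _ _ _ _ a1 x1x1 y0y0 y1y1 a2 ax ya ay)).
rewrite (gr x0 (r - e) y0 y1 x0x1 a7 y0y0 y1y1 a1 y01 (Or41 _ _ _ a2)).
rewrite (gr (r + e) x1 y0 y1 a9 x1x1 y0y0 y1y1 a4 y01 (Or42 _ _ _ a3)).
rewrite (rect_split_y b1 b7 a5 (bc _ _ _ _ a1 a4 y0y0 y1y1 a2 a3 ya ay)).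
rewrite (rect_split_y b5 b4 a5 (bc _ _ _ _ a1 a4 b1 y1y1 a2 a3 b2 ay)).
rewrite (gr _ _ y0 (t - e) a1 a4 y0y0 b7 a5 b1 (Or43 _ _ _ b2)).
rewrite (gr _ _ (t + e) y1 a1 a4 b9 y1y1 a5 b4 (Or44 _ _ _ b3)).
rewrite add0r add0r addr0 addr0.
have H : nm (rect_int g (r - e) (r + e) (t - e) (t + e)) <=
    4 * (`|K| + 1) * ((r + e - (r - e)) + (t + e - (t - e))).
  apply: (rect_int_le a5 b5); first exact: bc a1 a4 b1 b4 a2 a3 b2 b3.
  move=> z [/andP[h1 h2] /andP[h3 h4] hz]; apply: (@le_trans _ _ K); last first.
    by apply: le_trans (ler_norm K) _; rewrite lerDl.
  apply: hK.
    apply: neq; case: hz => ->; [left|left|right|right].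
    - by rewrite lt_eqF.
    - by rewrite gt_eqF.
    - by rewrite lt_eqF.
    - by rewrite gt_eqF.
  apply: le_lt_trans (nm_le_ReIm _) _.
  have -> : Re (z - a) = Re z - r by clear; rewrite /r; case: (z) (a) => ? ? [].
  have -> : Im (z - a) = Im z - t by clear; rewrite /t; case: (z) (a) => ? ? [].
  have n1 : `|Re z - r| <= e.
    by clear -h1 h2; rewrite ler_norml; apply/andP; split; lra.
  have n2 : `|Im z - t| <= e.
    by clear -h3 h4; rewrite ler_norml; apply/andP; split; lra.
  by clear -n1 n2 ed d0; lra.
apply: le_trans H _.
have -> : 4 * (`|K| + 1) * (r + e - (r - e) + (t + e - (t - e))) =
  e * (16 * (`|K| + 1)) by ring.
by rewrite -ler_pdivlMr // mulr_gt0.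
Qed.

End PuncturedRectangle.

(** * The Cauchy integral over a square and the identity theorem *)

Section Cauchy.
Variable R : realType.
Local Notation C := (Cplx R).

Section Square.
Variable s : R.
Hypothesis s0 : 0 < s.
Local Notation sq g := (rect_int g (- s) s (- s) s).
Local Notation bd z := (on_boundary (- s) s (- s) s z).
Local Notation bcont := (boundary_cont (- s) s (- s) s).

Let ss : - s <= s. Proof. by have := s0; lra. Qed.

Lemma boundary_nm (z : C) : bd z -> s <= nm z.
Proof.
have hs : `|s| = s by rewrite gtr0_norm.
by move=> [_ _ [] e]; [have := Re_le_nm z|have := Re_le_nm z|
  have := Im_le_nm z|have := Im_le_nm z]; rewrite e ?normrN hs.
Qed.

Lemma boundary_sub_nm (z a : C) : bd z -> s - nm a <= nm (z - a).
Proof.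
move=> /boundary_nm hz; have := nmD (z - a) a; rewrite subrK => h; lra.
Qed.

Lemma boundary_neq (z a : C) : bd z -> nm a < s -> z - a != 0.
Proof.
move=> /(boundary_sub_nm a) h1 h2; rewrite -nm_eq0 gt_eqF //; lra.
Qed.

Lemma nm0 : nm (0 : C) = 0. Proof. by rewrite /nm normr0. Qed.

Lemma nmV (z : C) : nm z^-1 = (nm z)^-1.
Proof. by apply: (@complexI R); rewrite fmorphV /= -!nmE normfV. Qed.

Lemma bcont_div (phi : C -> C) (a : C) : bcont phi -> nm a < s ->
  bcont (fun z => phi z / (z - a)).
Proof.
move=> hphi ha z hz.
apply: (@cvgM _ _ (nbhs z) _ phi (fun z => (z - a)^-1)); first exact: hphi.
apply: (@cvgV _ _ (nbhs z) _ (fun z => z - a)); first exact: boundary_neq.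
have -> : (fun z => z - a) = (fun z => - a + 1 * z).
  by apply/funext => w; rewrite mul1r addrC.
have -> : z - a = - a + 1 * z by rewrite mul1r addrC.
exact: affine_continuous.
Qed.

Lemma bcont_div0 (phi : C -> C) : bcont phi -> bcont (fun z => phi z / z).
Proof.
move=> hphi; have -> : (fun z => phi z / z) = (fun z => phi z / (z - 0)).
  by apply/funext => z; rewrite subr0.
by apply: bcont_div => //; rewrite nm0.
Qed.

Lemma bcont_Z (k : C) (phi : C -> C) : bcont phi -> bcont (fun z => k * phi z).
Proof.
move=> hphi z hz; apply: (@cvgM _ _ (nbhs z) _ (fun=> k) phi).
  exact: (@cst_continuous C C k).
exact: hphi.
Qed.

Lemma bcont_V (a : C) : nm a < s -> bcont (fun z => (z - a)^-1).
Proof.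
move=> ha; have -> : (fun z => (z - a)^-1) = (fun z => 1 / (z - a)).
  by apply/funext => z; rewrite mul1r.
by apply: (@bcont_div (fun=> 1)) => // z _; exact: (@cst_continuous C C 1).
Qed.

(** Cauchy integral over the square of side [2 s], without the factor [1 / (2 i
    pi)]. *)
Definition cauchy_int (phi : C -> C) (a : C) : C := sq (fun z => phi z / (z - a)).

Lemma cauchy_int_bound (phi : C -> C) (M : R) (a : C) : bcont phi -> nm a < s ->
  (forall z, bd z -> nm (phi z) <= M) ->
  nm (cauchy_int phi a) <= 4 * (M / (s - nm a)) * (s - - s + (s - - s)).
Proof.
move=> hphi ha hM; apply: (rect_int_le ss ss (bcont_div hphi ha)) => z hz.
 rewrite nmM nmV; apply: ler_pM; rewrite ?nm_ge0 ?invr_ge0 ?nm_ge0 ?hM //.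
by rewrite lef_pV2 ?boundary_sub_nm // posrE; have := boundary_sub_nm a hz; lra.
Qed.

(** One step of the geometric expansion of [1 / (z - a)] in powers of [a / z]. *)
Lemma cauchy_int_step (phi : C -> C) (a : C) : bcont phi -> nm a < s ->
  cauchy_int phi a = sq (fun z => phi z / z) + a * cauchy_int (fun z => phi z / z) a.
Proof.
move=> hphi ha.
have h1 : bcont (fun z => phi z / z).
  exact: bcont_div0.
have h2 := bcont_div h1 ha.
have h3 : bcont (fun z => a * (phi z / z / (z - a))) by exact: bcont_Z.
rewrite /cauchy_int -(rect_intZ ss ss a h2) -(rect_intD ss ss h1 h3).
apply: (eq_rect_int ss ss) => z hz.
have z0 : z != 0 by rewrite -[z]subr0 boundary_neq // nm0.
have za := boundary_neq hz ha.
by field; rewrite z0 za.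
Qed.

(** Only non-vanishing of the winding integral is needed: each of the four sides
    contributes a positive imaginary part. *)
Lemma winding_neq0 (a : C) : nm a < s -> sq (fun z => (z - a)^-1) != 0.
Proof.
move=> ha; case: a ha => p q ha.
have hp := le_lt_trans (Re_le_nm _) ha; have hq := le_lt_trans (Im_le_nm _) ha.
rewrite /= in hp hq; move/ltr_normlP: hp => [hp1 hp2].
move/ltr_normlP: hq => [hq1 hq2].
have bc : bcont (fun z => (z - (p +i* q))^-1).
  exact: bcont_V.
have c1 := cont_hor ss (or_introl erefl) bc.
have c2 := cont_hor ss (or_intror erefl) bc.
have c3 := cont_ver ss (or_intror erefl) bc.
have c4 := cont_ver ss (or_introl erefl) bc.
suff : 0 < Im (sq (fun z => (z - (p +i* q))^-1)).
  by apply: contraTneq => ->; rewrite ltxx.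
have lts : - s < s by lra.
have cont_M (k : C) u : cont_on (- s) s u -> cont_on (- s) s (fun x => k * u x).
  move=> hu x hx; apply: (@cvgM _ _ (nbhs x) _ (fun=> k) u).
    exact: (@cst_continuous R C k).
  exact: hu.
have low (u v : R) : 0 < v -> v <= 2 * s -> `|u| <= 2 * s ->
    v / (8 * s ^+ 2) <= v / (u ^+ 2 + v ^+ 2).
  move=> v0 vs us; rewrite ler_pM2l // lef_pV2 ?posrE; last 2 first.
  - by rewrite mulr_gt0 ?exprn_gt0.
  - by rewrite ltr_wpDl ?sqr_ge0 ?exprn_gt0.
  have : u ^+ 2 <= (2 * s) ^+ 2 by rewrite -real_normK ?num_real // ler_sqr ?nnegrE ?normr_ge0 //; lra.
  have : v ^+ 2 <= (2 * s) ^+ 2 by rewrite ler_sqr ?nnegrE; lra.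
  rewrite exprMn => h1 h2; lra.
have posd (v : R) : 0 < v -> 0 < v / (8 * s ^+ 2).
  by move=> v0; rewrite divr_gt0 // mulr_gt0 // exprn_gt0.
have inv (u v : R) : ((u +i* v)^-1 : C) = (u / (u ^+ 2 + v ^+ 2)) -i* (v / (u ^+ 2 + v ^+ 2)).
  by [].
rewrite /rect_int mulrBr -(cintZ 'i c3) -(cintZ 'i c4).
rewrite -[X in _ + X + _]mulN1r -(cintZ (-1) c2).
rewrite -[X in _ + (_ + X)]mulN1r -(cintZ (-1) (cont_M _ _ c4)).
have ImD (y z : C) : Im (y + z) = Im y + Im z by case: y z => ? ? [].
rewrite !ImD; apply: addr_gt0; apply: addr_gt0.
- apply: (@cint_Im_gt0 _ _ _ ((s + q) / (8 * s ^+ 2)) _ lts _ c1).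
    by apply: posd; lra.
  move=> x /andP[t1 t2].
  have -> : (x +i* - s - (p +i* q) : C) = (x - p) +i* (- (s + q)).
    by rewrite opprD; simpc.
  rewrite inv /= mulNr opprK sqrrN; apply: low; try lra.
  by rewrite ler_norml; apply/andP; split; lra.
- apply: (@cint_Im_gt0 _ _ _ ((s - q) / (8 * s ^+ 2)) _ lts _ (cont_M _ _ c2)).
    by apply: posd; lra.
  move=> x /andP[t1 t2].
  have -> : (x +i* s - (p +i* q) : C) = (x - p) +i* (s - q) by simpc.
  rewrite inv mulN1r /= opprK; apply: low; try lra.
  by rewrite ler_norml; apply/andP; split; lra.
- apply: (@cint_Im_gt0 _ _ _ ((s - p) / (8 * s ^+ 2)) _ lts _ (cont_M _ _ c3)).
    by apply: posd; lra.
  move=> y /andP[t1 t2].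
  have -> : (s +i* y - (p +i* q) : C) = (s - p) +i* (y - q) by simpc.
  rewrite inv /= mul0r mul1r add0r.
  rewrite [X in _ <= _ / X]addrC; apply: low; try lra.
  by rewrite ler_norml; apply/andP; split; lra.
- apply: (@cint_Im_gt0 _ _ _ ((s + p) / (8 * s ^+ 2)) _ lts _
    (cont_M _ _ (cont_M _ _ c4))).
    by apply: posd; lra.
  move=> y /andP[t1 t2].
  have -> : (- s +i* y - (p +i* q) : C) = (- (s + p)) +i* (y - q).
    by rewrite opprD; simpc.
  rewrite inv mulN1r /= mul0r mul1r add0r mulNr opprK sqrrN.
  rewrite [X in _ <= _ / X]addrC; apply: low; try lra.
  by rewrite ler_norml; apply/andP; split; lra.
Qed.

Lemma in_rect_bd z : bd z -> in_rect (- s) s (- s) s z.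
Proof. by case. Qed.

Lemma cauchy_formula (f : C -> C) (a : C) : nm a < s ->
  (forall z, in_rect (- s) s (- s) s z -> derivable f z 1) ->
  cauchy_int f a = f a * sq (fun z => (z - a)^-1).
Proof.
move=> ha hf.
have bf : bcont f by move=> z /in_rect_bd /hf; exact: derivable_continuous.
have hp := le_lt_trans (Re_le_nm _) ha; have hq := le_lt_trans (Im_le_nm _) ha.
move/ltr_normlP: hp => [hp1 hp2]; move/ltr_normlP: hq => [hq1 hq2].
have ain : in_rect (- s) s (- s) s a by split; apply/andP; split; lra.
have bc1 : bcont (fun z => (z - a)^-1).
  exact: bcont_V.
have : sq (fun z => (f z - f a) / (z - a)) = 0.
  apply: (@rect_int_punctured R _ a); try (by apply/andP; split; lra).
    move=> z hz za.
    apply: (@derivableM _ _ (fun z => f z - f a) (fun z => (z - a)^-1)).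
      by apply: (@derivableB _ _ _ f (fun=> f a)); [exact: hf|exact: derivable_cst].
    apply: (@derivableV _ _ (fun z => z - a)); first by rewrite subr_eq0.
    by apply: (@derivableB _ _ _ id (fun=> a)); [exact: derivable_id|exact: derivable_cst].
  have [L hL] := derivable_expansion (hf a ain).
  have [d d0 hd] := hL 1 ltr01.
  exists (nm L + 1), d; split => // z za zd.
  have zan : 0 < nm (z - a) by rewrite lt_neqAle nm_ge0 eq_sym nm_eq0 subr_eq0 za.
  rewrite nmM nmV ler_pdivrMr // mulrDl -nmM.
  have -> : f z - f a = L * (z - a) + (f z - (f a + L * (z - a))) by ring.
  by apply: le_trans (nmD _ _) _; rewrite lerD2l; exact: hd.
rewrite (@eq_rect_int _ _ _ _ _ ss ss _ (fun z => f z / (z - a) + - f a * (z - a)^-1)); last first.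
  by move=> z _; rewrite mulrBl mulNr.
rewrite (rect_intD ss ss (bcont_div bf ha) (bcont_Z bc1)).
by rewrite (rect_intZ ss ss _ bc1) mulNr => /eqP; rewrite subr_eq0 => /eqP.
Qed.

(** If the zeros of [f] accumulate at [0], the successive coefficients of the
    expansion of the Cauchy integral at [0] vanish one after the other; the
    remainder then tends to [0] geometrically on the disc of radius [s]. *)
Theorem identity_disc (f : C -> C) :
  (forall z, in_rect (- s) s (- s) s z -> derivable f z 1) ->
  (forall e, 0 < e -> exists z, [/\ z != 0, nm z < e & f z = 0]) ->
  forall a, nm a < s -> f a = 0.
Proof.
move=> hf hz a ha.
have bf : bcont f by move=> z /in_rect_bd /hf; exact: derivable_continuous.
pose phi k := iter k (fun (u : C -> C) z => u z / z) f.
have bphi k : bcont (phi k).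
  elim: k => [//|k IH] /=.
  exact: bcont_div0.
have [M hM] := boundary_bounded ss ss bf.
have M0 : 0 <= M.
  apply: le_trans (hM (s +i* s) _); first exact: nm_ge0.
  by split; rewrite /= ?lexx ?ss //; constructor 2.
have phiM k z : bd z -> nm (phi k z) <= M / s ^+ k.
  move=> bz; elim: k => [|k IH]; first by rewrite expr0 divr1; exact: hM.
  rewrite /= nmM nmV exprSr invfM mulrA; apply: ler_pM; rewrite ?nm_ge0 ?invr_ge0 ?nm_ge0 //.
  rewrite lef_pV2 ?posrE //; first exact: boundary_nm.
  exact: lt_le_trans (boundary_nm bz).
(* Z k: the Cauchy integral of f / z ^ k vanishes at the zeros of f *)
pose Z k := forall b, b != 0 -> nm b < s -> f b = 0 -> cauchy_int (phi k) b = 0.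
have step k : Z k -> sq (fun z => phi k z / z) = 0 /\ Z k.+1.
  move=> Zk.
  have b0 : sq (fun z => phi k z / z) = 0.
    apply/eqP; rewrite -nm_eq0 eq_le nm_ge0 andbT.
    apply/ler_addgt0Pr => e e0; rewrite add0r.
    pose B := 4 * (M / s ^+ k.+1 / (s / 2)) * (s - - s + (s - - s)).
    have B0 : 0 <= B.
      have h1 : 0 <= M / s ^+ k.+1 / (s / 2).
        by rewrite !divr_ge0 ?exprn_ge0 // ltW.
      by rewrite /B; apply: mulr_ge0; [exact: mulr_ge0|have := s0; lra].
    have de : 0 < Num.min (s / 2) (e / (B + 1)).
      by rewrite lt_min !divr_gt0 // ltr_wpDl.
    have [b [bn0 bs fb]] := hz _ de.
    move: bs; rewrite lt_min => /andP[bs be].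
    have bs' : nm b < s by have := s0; lra.
    (* the constant coefficient is - b times a bounded quantity, and b tends to 0 *)
    have := cauchy_int_step (bphi k) bs'; rewrite (Zk b) //.
    move=> /esym/eqP; rewrite addr_eq0 => /eqP ->.
    rewrite nmN nmM.
    apply: le_trans (_ : nm b * (B + 1) <= _).
      rewrite ler_wpM2l ?nm_ge0 //.
      apply: le_trans (cauchy_int_bound (bphi k.+1) bs' (phiM k.+1)) _.
      apply: le_trans (_ : B <= _); last by rewrite lerDl.
      rewrite /B; apply: ler_wpM2r; first by have := s0; lra.
      apply: ler_wpM2l => //; apply: ler_wpM2l; first by rewrite divr_ge0 ?exprn_ge0 // ltW.
      by rewrite lef_pV2 ?posrE; have := s0; lra.
    by rewrite -ler_pdivlMr ?ltW // ltr_wpDl.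
  split => // b bn0 bs fb.
  have := cauchy_int_step (bphi k) bs; rewrite (Zk b) // b0 add0r.
  by move=> /esym/eqP; rewrite mulf_eq0 (negbTE bn0) => /eqP.
have Zall k : Z k.
  elim: k => [|k /step []//].
  by move=> b _ bs fb; rewrite /= cauchy_formula // fb mul0r.
have pow N : cauchy_int f a = a ^+ N * cauchy_int (phi N) a.
  elim: N => [|N IH]; first by rewrite expr0 mul1r.
  rewrite IH (cauchy_int_step (bphi N) ha) (step N (Zall N)).1 add0r.
  by rewrite exprSr mulrA.
have c0 : cauchy_int f a = 0.
  apply/eqP; rewrite -nm_eq0 eq_le nm_ge0 andbT.
  apply/ler_addgt0Pr => e e0; rewrite add0r.
  pose B := 4 * (M / (s - nm a)) * (s - - s + (s - - s)).
  have B0 : 0 <= B.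
    have h : 0 < s - nm a by lra.
    have h1 : 0 <= M / (s - nm a) by rewrite divr_ge0 // ltW.
    by rewrite /B; apply: mulr_ge0; [exact: mulr_ge0|have := s0; lra].
  have q0 : 0 <= nm a / s by rewrite divr_ge0 ?nm_ge0 // ltW.
  have q1 : nm a / s < 1 by rewrite ltr_pdivrMr // mul1r.
  have : (fun n => geometric (B + 1) (nm a / s) n) @ \oo --> 0.
    by apply: cvg_geometric; rewrite ger0_norm.
  move=> /cvgrPdist_le /(_ _ e0) [N _ /(_ N)] /=; rewrite leqnn => /(_ isT).
  rewrite sub0r normrN /geometric /= ger0_norm; last first.
    by rewrite mulr_ge0 ?exprn_ge0 // addr_ge0.
  apply: le_trans; rewrite (pow N) nmM.
  have nmX (z : C) n : nm (z ^+ n) = nm z ^+ n.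
    by apply: (@complexI R); rewrite rmorphXn /= -!nmE normrX.
  have := cauchy_int_bound (bphi N) ha (phiM N).
  move=> /(ler_wpM2l (exprn_ge0 N (nm_ge0 a))); rewrite nmX => h.
  apply: le_trans h _; rewrite expr_div_n.
  have -> : nm a ^+ N * (4 * (M / s ^+ N / (s - nm a)) * (s - - s + (s - - s))) =
      B * (nm a ^+ N / s ^+ N).
    by rewrite /B; field; rewrite expf_neq0 ?gt_eqF //; lra.
  rewrite ler_wpM2r ?divr_ge0 ?exprn_ge0 ?nm_ge0 ?lerDl // ltW //.
move: c0; rewrite cauchy_formula // => /eqP.
by rewrite mulf_eq0 (negbTE (winding_neq0 ha)) orbF => /eqP.
Qed.

End Square.
End Cauchy.

(** * Identity theorems and continuation in two variables *)

Section Boxes.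
Variable R : realType.
Local Notation C := (Cplx R).

(** The open polydisc of radius [e] and centre [p]. *)
Definition box (p : C2 R) (e : R) (q : C2 R) := forall j, nm (q 0 j - p 0 j) < e.

Lemma nbhs_box (p : C2 R) (A : set (C2 R)) :
  nbhs p A -> exists2 e, 0 < e & box p e `<=` A.
Proof.
move=> /nbhs_ballP[e' /= /pos_complexE[e e0 ->] hA]; exists e => // q hq.
apply: hA; split=> [|i j]; first by rewrite ltcR.
rewrite ord1 -ball_normE /= distrC nmE ltcR; exact: hq.
Qed.

Lemma box_nbhs (p : C2 R) (e : R) : 0 < e -> nbhs p (box p e).
Proof.
move=> e0; apply/nbhs_ballP; exists (e%:C : C) => [|q [_ hq] j] /=; first by rewrite ltcR.
by have := hq 0 j; rewrite -ball_normE /= distrC nmE ltcR.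
Qed.

Lemma box_trans p q r d e : box p d q -> box q e r -> box p (d + e) r.
Proof.
move=> h1 h2 j; have -> : r 0 j - p 0 j = (q 0 j - p 0 j) + (r 0 j - q 0 j) by ring.
by apply: le_lt_trans (nmD _ _) _; apply: ltrD.
Qed.

Lemma box_sym p q e : box p e q -> box q e p.
Proof. by move=> h j; rewrite -opprB nmN. Qed.

Lemma box_le p q d e : d <= e -> box p d q -> box p e q.
Proof. by move=> de h j; apply: lt_le_trans de. Qed.

(** The identity theorem on the complex line through [p] in the direction [v]. *)
Lemma line_zero (F : C2 R -> C) (p v : C2 R) (s : R) : 0 < s ->
  (forall t : C, nm t <= 2 * s -> differentiable F (p + t *: v)) ->
  (forall e, 0 < e -> exists z : C, [/\ z != 0, nm z < e & F (p + z *: v) = 0]) ->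
  forall a, nm a < s -> F (p + a *: v) = 0.
Proof.
move=> s0 hF hz; apply: (@identity_disc R s s0 (fun t => F (p + t *: v))) => // t.
move=> [/andP[h1 h2] /andP[h3 h4]]; apply/derivable1_diffP.
apply: (@differentiable_comp _ _ _ _ (fun t : C => p + t *: v) F).
  apply: (@differentiableD _ _ _ (fun=> p) (fun t : C => t *: v)).
    exact: differentiable_cst.
  exact: (@differentiableZl _ _ _ id).
apply: hF; apply: le_trans (nm_le_ReIm _) _.
have : `|Re t| <= s by rewrite ler_norml h1 h2.
have : `|Im t| <= s by rewrite ler_norml h3 h4.
lra.
Qed.

Lemma nm_real (x : R) : nm (x%:C : C) = `|x|.
Proof. by rewrite /nm norm_real. Qed.

Lemma small_real (e : R) : 0 < e -> exists z : C, z != 0 /\ nm z < e.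
Proof.
move=> e0; exists ((e / 2)%:C); rewrite nm_real -nm_eq0 nm_real ger0_norm; last lra.
by split; [apply/eqP|]; lra.
Qed.

(** The radius on which [F] is shown to vanish depends on the domain of
    holomorphy only, not on the neighbourhood where [F] is known to vanish. *)
Lemma box_zero (F : C2 R -> C) (p : C2 R) (rho e : R) : 0 < rho -> 0 < e ->
  (forall q, box p rho q -> differentiable F q) ->
  (forall q, box p e q -> F q = 0) ->
  forall q, box p (rho / 4) q -> F q = 0.
Proof.
move=> r0 e0 hF hz q hq.
have -> : q = p + 1 *: (q - p) by rewrite scale1r addrC subrK.
apply: (@line_zero F p (q - p) 2) => //.
- move=> t ht; apply: hF => j; rewrite !mxE [p 0 j + _]addrC addrK nmM.
  have h := hq j; have t0 := nm_ge0 t.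
  apply: le_lt_trans (_ : 4 * nm (q 0 j - p 0 j) < _); last by lra.
  by rewrite ler_wpM2r ?nm_ge0 //; lra.
- move=> d d0.
  have m0 : 0 < Num.min d (e / rho) by rewrite lt_min d0 divr_gt0.
  have [z [z0]] := small_real m0.
  rewrite lt_min => /andP[zd ze]; exists z; split => //; apply: hz => j.
  rewrite !mxE [p 0 j + _]addrC addrK nmM; move: ze; rewrite ltr_pdivlMr // => ze.
  apply: le_lt_trans ze; rewrite ler_wpM2l ?nm_ge0 //.
  by have := hq j; lra.
- by have := nm_real 1; rewrite normr1 => -> ; lra.
Qed.

(** The point [(z, w)]. *)
Definition pt (z w : C) : C2 R := \row_j (if j == 0 then z else w).

Lemma pt_eta (p : C2 R) : p = pt (p 0 0) (p 0 1).
Proof.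
by apply/rowP => -[[|[|//]] hi]; rewrite !mxE; congr (p 0 _); apply/val_inj.
Qed.

Lemma ord2P (P : 'I_2 -> Prop) : P 0 -> P 1 -> forall j, P j.
Proof.
move=> h0 h1 [[|[|//]] hi].
  by rewrite (_ : Ordinal hi = 0) //; apply/val_inj.
by rewrite (_ : Ordinal hi = 1) //; apply/val_inj.
Qed.

Lemma box_pt z w z' w' e : nm (z' - z) < e -> nm (w' - w) < e ->
  box (pt z w) e (pt z' w').
Proof. by move=> h1 h2; apply: ord2P; rewrite !mxE. Qed.

(** The points [(1 + i t) / (1 - i t)] of the unit circle accumulate at [1]. *)
Lemma near_one (e : R) : 0 < e ->
  exists z : C, [/\ z != 0, nm z < e & `|1 + z| = 1].
Proof.
move=> e0; pose t := e / 4; have t0 : 0 < t by rewrite /t; lra.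
pose u : C := 1 -i* t; pose v : C := 1 +i* t.
have u1 : 1 <= nm u by apply: le_trans (Re_le_nm u); rewrite /= normr1.
have u0 : u != 0 by rewrite -nm_eq0 gt_eqF //; lra.
have uv : nm u = nm v by rewrite /nm !normc_def /= sqrrN.
have d : v - u = (2 * t)%:C * 'i :> C.
  rewrite /u /v; apply/eqP; rewrite eq_complex /=.
  by apply/andP; split; apply/eqP; ring.
have nd : nm (v - u) = 2 * t.
  rewrite d nmM nm_real ger0_norm; last lra.
  by rewrite /nm norm_i /= mulr1.
exists (v / u - 1); have -> : v / u - 1 = (v - u) / u by field.
split.
- by rewrite mulf_neq0 ?invr_eq0 // -nm_eq0 nd gt_eqF //; lra.
- rewrite nmM nmV nd ltr_pdivrMr; last lra.
  by have : e * 1 <= e * nm u by [rewrite ler_wpM2l // ltW]; rewrite /t; lra.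
- have -> : 1 + (v - u) / u = v / u by field.
  by rewrite nmE nmM nmV uv divff // -uv gt_eqF //; lra.
Qed.

(** The torus is a uniqueness set: the identity theorem is applied in [z] for
    [w] on the circle, then in [w]. *)
Lemma torus_zero (F : C2 R -> C) (rho : R) : 0 < rho ->
  (forall q, box (pt 1 1) rho q -> differentiable F q) ->
  (forall q, box (pt 1 1) rho q -> torus2 R q -> F q = 0) ->
  forall q, box (pt 1 1) (rho / 4) q -> F q = 0.
Proof.
move=> r0 hF hz q.
have r4 : 0 < rho / 4 by lra.
have e1 (z w t : C) : pt (z + t) w = pt z w + t *: pt 1 0.
  by apply/rowP; apply: ord2P; rewrite !mxE /= ?mulr1 ?mulr0 ?addr0.
have e2 (z w t : C) : pt z (w + t) = pt z w + t *: pt 0 1.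
  by apply/rowP; apply: ord2P; rewrite !mxE /= ?mulr1 ?mulr0 ?addr0.
have h1 w t : `|w| = 1 -> nm (w - 1) < rho -> nm t < rho / 4 -> F (pt (1 + t) w) = 0.
  move=> w1 wr tr; rewrite e1; apply: (line_zero r4) => // [z hzz|e e0].
    rewrite -e1; apply: hF; apply: box_pt => //.
    rewrite addrC addKr; lra.
  have m0 : 0 < Num.min e rho by rewrite lt_min e0.
  have [z [z0]] := near_one m0; rewrite lt_min => /andP[ze zr] z1.
  exists z; split => //; rewrite -e1; apply: hz.
    by apply: box_pt => //; rewrite addrC addKr.
  by rewrite /torus2 /= !mxE.
rewrite (pt_eta q) => hq.
have hq0 := hq 0; have hq1 := hq 1; rewrite !mxE /= in hq0 hq1.
rewrite -[q 0 1](subrK 1) [_ + 1]addrC e2; apply: (line_zero r4) => // [z hzz|e e0].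
  rewrite -e2; apply: hF; apply: box_pt; first by lra.
  rewrite addrC addKr; lra.
have m0 : 0 < Num.min e rho by rewrite lt_min e0.
have [z [z0]] := near_one m0; rewrite lt_min => /andP[ze zr] z1.
exists z; split => //; rewrite -e2 -[q 0 0](subrK 1) [_ + 1]addrC.
by apply: h1 => //; rewrite addrC addKr.
Qed.

(** Analytic continuation along the segment from [p] to [0], for a property that
    is locally the vanishing of a holomorphic function. *)
Lemma continuation (good : set (C2 R)) (p : C2 R) :
  (forall j, nm (p 0 j) <= 1) ->
  (forall t : R, 0 <= t <= 1 -> exists (F : C2 R -> C) (rho : R), [/\ 0 < rho,
    forall q, box (t%:C *: p) rho q -> differentiable F q &
    forall q, box (t%:C *: p) rho q -> (good q <-> F q = 0)]) ->
  (exists2 e, 0 < e & box p e `<=` good) ->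
  exists2 e, 0 < e & box 0 e `<=` good.
Proof.
move=> hp hloc [e0 e00 he0].
pose c (t : R) : C2 R := (1 - t)%:C *: p.
pose S : set R := [set t | 0 <= t <= 1 /\ exists2 e, 0 < e & box (c t) e `<=` good].
have c0 : c 0 = p by rewrite /c subr0 scale1r.
have c1 : c 1 = 0 by rewrite /c subrr scale0r.
have S0 : S 0.
  by split; [rewrite lexx ler01|exists e0 => //; rewrite c0].
have cdist t t' e : `|t - t'| < e -> box (c t) e (c t').
  move=> tt j; rewrite !mxE -mulrBl nmM -rmorphB nm_real.
  have -> : 1 - t' - (1 - t) = t - t' by ring.
  by apply: le_lt_trans tt; rewrite ler_piMr.
have Sub : ubound S 1 by move=> t [/andP[]].
pose tau := sup S.
have t0 : 0 <= tau by apply: ub_le_sup => //; exists 1.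
have t1 : tau <= 1 by apply: ge_sup => //; exists 0.
have [|F [rho [r0 hF hg]]] := hloc (1 - tau).
  by apply/andP; split; lra.
have hS : has_sup S by split; [exists 0|exists 1].
have [t St tt] : exists2 t, S t & tau - rho / 10 < t.
  by apply: sup_adherent => //; lra.
have ttau : t <= tau by apply: ub_le_sup => //; exists 1.
have [_ [e e_gt0 he]] := St.
have hb : box (c tau) (rho / 10) (c t) by apply: cdist; rewrite ger0_norm; lra.
have hm : 0 < Num.min e (rho / 2) by rewrite lt_min e_gt0 /=; lra.
have zero q : box (c t) (rho / 2 / 4) q -> F q = 0.
  apply: (box_zero _ hm); first lra.
    move=> q' hq'; apply: hF; apply: box_le (box_trans hb hq'); lra.
  move=> q' hq'; apply/hg.
    have hq2 : box (c t) (rho / 2) q' by apply: box_le hq'; rewrite ge_min lexx orbT.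
    by apply: box_le (box_trans hb hq2); lra.
  by apply: he; apply: box_le hq'; rewrite ge_min lexx.
(* the box of radius rho / 8 around c t contains a neighbourhood of c tau *)
have good_tau q : box (c tau) (rho / 40) q -> good q.
  move=> hq; apply/hg; first by apply: box_le hq; lra.
  by apply: zero; apply: box_le (box_trans (box_sym hb) hq); lra.
have [tau1|tau1] := eqVneq tau 1.
  exists (rho / 40); first lra.
  by move=> q hq; apply: good_tau; rewrite tau1 c1.
exfalso; have lt1 : tau < 1 by rewrite lt_neqAle tau1.
(* otherwise the continuation extends beyond the supremum *)
pose t' := tau + Num.min (1 - tau) (rho / 100).
have m1 : 0 < Num.min (1 - tau) (rho / 100) by rewrite lt_min; apply/andP; split; lra.
have m2 : Num.min (1 - tau) (rho / 100) <= 1 - tau by rewrite ge_min lexx.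
have m3 : Num.min (1 - tau) (rho / 100) <= rho / 100 by rewrite ge_min lexx orbT.
have : S t'.
  split; first by rewrite /t'; apply/andP; split; lra.
  exists (rho / 80); first lra.
  move=> q hq; apply: good_tau.
  have h : box (c tau) (rho / 90) (c t') by apply: cdist; rewrite /t' ltr_norml; apply/andP; split; lra.
  by apply: box_le (box_trans h hq); lra.
move=> /(ub_le_sup (ex_intro _ 1 Sub)); rewrite -/tau /t'; lra.
Qed.

End Boxes.

(** * Tangency to the sphere and the annihilating form *)

Section Tangency.
Variable R : realType.
Local Notation C := (Cplx R).

(** The bilinear (not Hermitian) pairing, so that it is holomorphic in both
    arguments. *)
Definition dot (a b : C2 R) : C := a 0 0 * b 0 0 + a 0 1 * b 0 1.

(** Coordinatewise complex conjugate. *)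
Definition conjv (q : C2 R) : C2 R := \row_j (conjc (q 0 j) : C).

Lemma nm_sqr (z : C) : nm z ^+ 2 = Re z ^+ 2 + Im z ^+ 2.
Proof. by rewrite /nm normc_def /= sqr_sqrtr // addr_ge0 // sqr_ge0. Qed.

Lemma sphere3_nm (r : R) (q : C2 R) :
  sphere3 r q -> nm (q 0 0) ^+ 2 + nm (q 0 1) ^+ 2 = r ^+ 2.
Proof.
rewrite /sphere3 /= !nmE => h; apply: (@complexI R).
by rewrite rmorphD /= !rmorphXn /= -h.
Qed.

(** The velocity [v] is the limit of [h = (g t - q) / t]; expanding [|q + t h|^2
    = |q|^2] bounds the real part of the pairing of [h] with the conjugate of
    [q] by a multiple of [t]. *)
Lemma tangent_sphere (r : R) (q v : C2 R) :
  tangent_space (sphere3 r) q v -> Re (dot (conjv q) v) = 0.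
Proof.
move=> [g [g0 gS gv]].
apply/eqP; rewrite -normr_eq0 eq_le normr_ge0 andbT.
apply/ler_addgt0Pr => e e0; rewrite add0r.
pose N := nm (v 0 0) + nm (v 0 1) + 2.
pose K := nm (q 0 0) + nm (q 0 1) + 1.
have v00 := nm_ge0 (v 0 0); have v10 := nm_ge0 (v 0 1).
have q00 := nm_ge0 (q 0 0); have q10 := nm_ge0 (q 0 1).
have N0 : 1 <= N by rewrite /N; lra.
have K0 : 1 <= K by rewrite /K; lra.
pose d := Num.min 1 (e / (4 * K)).
have d0 : 0 < d by rewrite lt_min ltr01 divr_gt0 //; lra.
have [d1 d2] : d <= 1 /\ d <= e / (4 * K) by rewrite /d !ge_min !lexx orbT.
have /gv /nbhs_ballP [eps /= eps0 heps] := box_nbhs v d0.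
pose t := Num.min (eps / 2) (e / (2 * N ^+ 2)).
have N2 : 0 < N ^+ 2 by rewrite exprn_gt0 //; lra.
have t0 : 0 < t by rewrite lt_min !divr_gt0 // mulr_gt0.
have [t1 t2] : t <= eps / 2 /\ t <= e / (2 * N ^+ 2).
  by rewrite /t !ge_min !lexx orbT.
pose h : C2 R := (t^-1)%:C *: (g t - q).
have hv : box v d h.
  apply: heps; last by rewrite gt_eqF.
  by rewrite -ball_normE /= sub0r normrN gtr0_norm //; lra.
have gE j : g t 0 j = q 0 j + t%:C * h 0 j.
  by rewrite !mxE mulrA -rmorphM mulfV ?gt_eqF // mul1r; ring.
clearbody h.
have S1 := sphere3_nm (gS t); have S2 := sphere3_nm (gS 0); rewrite g0 in S2.
rewrite !gE !nm_sqr in S1; rewrite !nm_sqr in S2.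
have n0 : nm (h 0 0) <= N - 1 - nm (v 0 1).
  have := nmD (h 0 0 - v 0 0) (v 0 0); rewrite subrK /N => hh.
  by have := hv 0; lra.
have n1 : nm (h 0 1) <= N - 1 - nm (v 0 0).
  have := nmD (h 0 1 - v 0 1) (v 0 1); rewrite subrK /N => hh.
  by have := hv 1; lra.
have sm : nm (h 0 0) ^+ 2 + nm (h 0 1) ^+ 2 <= 2 * N ^+ 2.
  have s0 : nm (h 0 0) ^+ 2 <= N ^+ 2.
    by rewrite ler_sqr ?nnegrE ?nm_ge0 //; lra.
  have s1 : nm (h 0 1) ^+ 2 <= N ^+ 2.
    by rewrite ler_sqr ?nnegrE ?nm_ge0 //; lra.
  lra.
have diff : `|Re (dot (conjv q) v) - Re (dot (conjv q) h)| <= e / 4.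
  have -> : Re (dot (conjv q) v) - Re (dot (conjv q) h) =
      Re (dot (conjv q) (v - h)).
    rewrite /dot !mxE; case: (q 0 0) (q 0 1) (v 0 0) (v 0 1) (h 0 0) (h 0 1) =>
      ? ? [? ?] [? ?] [? ?] [? ?] [? ?] /=; ring.
  apply: le_trans (Re_le_nm _) _; apply: le_trans (nmD _ _) _.
  rewrite !nmM !mxE.
  have nc (z : C) : nm (conjc z) = nm z by rewrite /nm normcJ.
  rewrite !nc.
  have := hv 0; have := hv 1; rewrite -nmN opprB -[X in _ -> X < _ -> _]nmN opprB.
  move=> b1 b0.
  have c0 : nm (q 0 0) * nm (v 0 0 - h 0 0) <= nm (q 0 0) * d by rewrite ler_wpM2l // ltW.
  have c1 : nm (q 0 1) * nm (v 0 1 - h 0 1) <= nm (q 0 1) * d by rewrite ler_wpM2l // ltW.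
  apply: le_trans (_ : K * d <= _); first by rewrite /K; lra.
  have K4 : 0 < 4 * K by lra.
  by move: d2; rewrite ler_pdivlMr //; lra.
have hdot : `|Re (dot (conjv q) h)| <= e / 2.
  have E : t * (2 * Re (dot (conjv q) h) + t * (nm (h 0 0) ^+ 2 + nm (h 0 1) ^+ 2)) = 0.
    rewrite -[RHS](subrr (r ^+ 2)) -{1}S1 -S2 !nm_sqr /dot !mxE.
    by case: (q 0 0) (q 0 1) (h 0 0) (h 0 1) => ? ? [? ?] [? ?] [? ?] /=; ring.
  move/eqP: E; rewrite mulf_eq0 gt_eqF //= addr_eq0 => /eqP E.
  have -> : Re (dot (conjv q) h) = - (t * (nm (h 0 0) ^+ 2 + nm (h 0 1) ^+ 2) / 2) by lra.
  rewrite normrN ger0_norm; last by rewrite !mulr_ge0 ?addr_ge0 ?sqr_ge0 // ltW.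
  have : t * (nm (h 0 0) ^+ 2 + nm (h 0 1) ^+ 2) <= t * (2 * N ^+ 2).
    by rewrite ler_wpM2l // ltW.
  have N3 : 0 < 2 * N ^+ 2 by apply: mulr_gt0.
  move: t2; rewrite (ler_pdivlMr _ _ N3) => t2 h2; clear -t2 h2.
  by rewrite ler_pdivrMr //; lra.
have := ler_normD (Re (dot (conjv q) v) - Re (dot (conjv q) h)) (Re (dot (conjv q) h)).
by rewrite subrK; lra.
Qed.

Lemma complex_tangent_sphere (r : R) (q v : C2 R) :
  complex_tangent_space (sphere3 r) q v -> dot (conjv q) v = 0.
Proof.
move=> [/tangent_sphere h1 /tangent_sphere h2].
apply/eqP; rewrite eq_complex h1 eqxx /=; apply/eqP; move: h2.
rewrite /dot !mxE; case: (q 0 0) (q 0 1) (v 0 0) (v 0 1) => ? ? [? ?] [? ?] [? ?] /=.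
move=> h; apply: oppr_inj; rewrite oppr0 -h; ring.
Qed.

Lemma complex_tangency_dot (D : set (C2 R)) (F : foliation D) (r : R) (q : C2 R) k :
  complex_tangency F (sphere3 r) q -> fol_dom k q ->
  dot (conjv q) (fol_gen (f := F) k q) = 0.
Proof.
move=> [_ _ h] kq; apply: (@complex_tangent_sphere r); apply: h.
by exists k => //; exists 1; rewrite scale1r.
Qed.

Lemma dotZr c a b : dot a (c *: b) = c * dot a b.
Proof. by rewrite /dot !mxE; ring. Qed.

Lemma dotZl c a b : dot (c *: a) b = c * dot a b.
Proof. by rewrite /dot !mxE; ring. Qed.

Lemma differentiable_entry (u : C2 R -> C2 R) (p : C2 R) j :
  differentiable u p -> differentiable (fun q => u q 0 j : C) p.
Proof.
move=> hu; have h := @differentiable_coord C 1 2 (u p) 0 j.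
by have := differentiable_comp hu h.
Qed.

Lemma differentiable_dot (f g : C2 R -> C2 R) (p : C2 R) :
  differentiable f p -> differentiable g p ->
  differentiable (fun q => dot (f q) (g q)) p.
Proof.
move=> hf hg.
have hc := differentiable_entry.
apply: (@differentiableD _ _ _ (fun q => f q 0 0 * g q 0 0) (fun q => f q 0 1 * g q 0 1)).
  by apply: (@differentiableM _ _ (fun q => f q 0 0) (fun q => g q 0 0)); exact: hc.
by apply: (@differentiableM _ _ (fun q => f q 0 1) (fun q => g q 0 1)); exact: hc.
Qed.

Lemma fol_dot_indep (D : set (C2 R)) (F : foliation D) (k l : fol_chart F) a q :
  fol_dom k q -> fol_dom l q -> dot a (fol_gen k q) = 0 -> dot a (fol_gen l q) = 0.
Proof.
move=> kq lq; have [u [_ hu]] := fol_unit k l; have [u0 ->] := hu q kq lq.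
by move=> /eqP; rewrite dotZr mulf_eq0 (negbTE u0) => /eqP.
Qed.

(** The points of [W] over which the 1-form with coefficients [Q] vanishes on
    the tangent line of [F], whichever chart is used. *)
Definition annihilates (W D : set (C2 R)) (F : foliation D) (Phi Q : C2 R -> C2 R) :
  set (C2 R) :=
  [set p | W p /\ forall k : fol_chart F, fol_dom k (Phi p) ->
             dot (Q p) (fol_gen k (Phi p)) = 0].

Lemma foliation_continuation (W Omega D : set (C2 R)) (F : foliation D)
    (Phi Q : C2 R -> C2 R) :
  open W -> holomorphic W Phi -> Phi @` W = Omega ->
  closed_bidisc R `<=` W -> Omega `<=` D -> holomorphic W Q ->
  (forall p, torus2 R p -> annihilates W F Phi Q p) ->
  exists2 e, 0 < e & box 0 e `<=` annihilates W F Phi Q.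
Proof.
move=> oW hPhi PhiW bW OD hQ hT.
have loc p : W p -> exists (G : C2 R -> C) (rho : R), [/\ 0 < rho,
    forall q, box p rho q -> differentiable G q &
    forall q, box p rho q -> (annihilates W F Phi Q q <-> G q = 0)].
  move=> Wp.
  have [k _ kp] : (\bigcup_(k in [set: fol_chart F]) fol_dom k) (Phi p).
    by rewrite fol_cover; apply: OD; rewrite -PhiW; exists p.
  have nW : nbhs p W by apply: open_nbhs_nbhs.
  have nk : nbhs p (Phi @^-1` (fol_dom k)).
    apply: (differentiable_continuous (hPhi p Wp)).
    by apply: open_nbhs_nbhs; split => //; exact: fol_open.
  have [rho r0 hrho] := nbhs_box (filterI nW nk).
  exists (fun q => dot (Q q) (fol_gen k (Phi q))), rho; split.
  - exact: r0.
  - move=> q /hrho[Wq kq]; apply: (@differentiable_dot Q (fun q => fol_gen k (Phi q))); first exact: hQ.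
    apply: (@differentiable_comp _ _ _ _ Phi (fol_gen k)); first exact: hPhi.
    exact: fol_holo.
  - move=> q /hrho[Wq kq]; split => [[_]|h]; first exact.
    by split; [exact: Wq|move=> l lq; exact: fol_dot_indep kq lq h].
have pt11 : torus2 R (pt 1 1) by rewrite /torus2 /= !mxE /= normr1.
apply: (@continuation _ _ (pt 1 1)).
- by apply: ord2P; rewrite !mxE /= (nm_real 1) normr1.
- move=> t /andP[t0 t1]; apply: loc; apply: bW.
  by rewrite /closed_bidisc /= !mxE /= mulr1 nmE nm_real ger0_norm // -[1]/(1%:C) lecR.
have [G [rho [r0 hG hg]]] := loc _ (hT _ pt11).1.
exists (rho / 4); first lra.
move=> q hq; apply/hg; first by apply: box_le hq; lra.
apply: (torus_zero r0 hG) hq => q' hq' tq'; apply/hg => //; exact: hT.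
Qed.

End Tangency.

(** * Polynomial maps and their reversals *)

Section PolynomialMaps.
Variable R : realType.
Local Notation C := (Cplx R).

Section Differentiability.
Variable V : normedModType C.

Lemma differentiable_bigsum n (f : 'I_n -> V -> C) (p : V) :
  (forall i, differentiable (f i) p) -> differentiable (fun q => \sum_(i < n) f i q) p.
Proof.
move=> hf; have := differentiable_sum hf.
by congr (differentiable _ p); apply/funext => q; rewrite fct_sumE.
Qed.

Lemma differentiable_pow (f : V -> C) k (p : V) :
  differentiable f p -> differentiable (fun q => f q ^+ k) p.
Proof.
move=> hf; elim: k => [|k IH].
  under eq_fun do rewrite expr0; exact: differentiable_cst.
under eq_fun do rewrite exprS.
exact: (@differentiableM _ _ f (fun q => f q ^+ k)).
Qed.

Lemma differentiable_row (f : 'I_2 -> V -> C) (p : V) :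
  (forall j, differentiable (f j) p) -> differentiable (fun q => \row_j f j q : C2 R) p.
Proof.
move=> hf.
have -> : (fun q => \row_j f j q : C2 R) =
    (fun q => f 0 q *: (pt 1 0) + f 1 q *: (pt 0 1)).
  apply/funext => q; apply/rowP; apply: ord2P;
    by rewrite !mxE /= ?mulr1 ?mulr0 ?addr0 ?add0r.
apply: (@differentiableD _ _ _ (fun q => f 0 q *: pt 1 0) (fun q => f 1 q *: pt 0 1)).
  exact: differentiableZl.
exact: differentiableZl.
Qed.

End Differentiability.

Lemma differentiable_mono (c : C) m n (p : C2 R) :
  differentiable (fun q : C2 R => c * q 0 0 ^+ m * q 0 1 ^+ n : C) p.
Proof.
have h0 := differentiable_pow m (@differentiable_coord C 1 2 p 0 0).
have h1 := differentiable_pow n (@differentiable_coord C 1 2 p 0 1).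
have hc := @differentiable_cst C (C2 R) C c p.
by have := differentiableM (differentiableM hc h0) h1.
Qed.

Variables (N : nat) (a : 'I_2 -> nat -> nat -> C).

(** The polynomial map with coefficients [a j k l] of [z ^ k w ^ l], of degree
    at most [N] in each variable. *)
Definition ppol (p : C2 R) : C2 R :=
  \row_j \sum_(k < N.+1) \sum_(l < N.+1) a j k l * p 0 0 ^+ k * p 0 1 ^+ l.

(** The reversed conjugate of [ppol]: on the torus it equals [(z w) ^ N] times
    the conjugate. *)
Definition rpol (p : C2 R) : C2 R :=
  \row_j \sum_(k < N.+1) \sum_(l < N.+1)
    (conjc (a j k l) : C) * p 0 0 ^+ (N - k) * p 0 1 ^+ (N - l).

Lemma differentiable_ppol p : differentiable ppol p.
Proof.
apply: differentiable_row => j; apply: differentiable_bigsum => k.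
by apply: differentiable_bigsum => l; exact: differentiable_mono.
Qed.

Lemma differentiable_rpol p : differentiable rpol p.
Proof.
apply: differentiable_row => j; apply: differentiable_bigsum => k.
by apply: differentiable_bigsum => l; exact: differentiable_mono.
Qed.

Lemma conj_unit (z : C) : `|z| = 1 -> z * conjc z = 1.
Proof. by move=> z1; rewrite -sqr_normc z1 expr1n. Qed.

Lemma conj_exp (z : C) k : `|z| = 1 -> (k <= N)%N ->
  z ^+ N * (conjc z : C) ^+ k = z ^+ (N - k).
Proof.
move=> z1 kN; rewrite -{1}(subnK kN) exprD -mulrA -exprMn conj_unit // expr1n.
by rewrite mulr1.
Qed.

Lemma rpol_torus p : torus2 R p ->
  rpol p = (p 0 0 ^+ N * p 0 1 ^+ N) *: conjv (ppol p).
Proof.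
move=> [/= z1 w1]; apply/rowP => j; rewrite !mxE.
rewrite (rmorph_sum (@conjc R)) mulr_sumr; apply: eq_bigr => k _.
rewrite (rmorph_sum (@conjc R)) mulr_sumr; apply: eq_bigr => l _.
rewrite !(rmorphM (@conjc R)) !(rmorphXn (@conjc R)) /=.
rewrite -(conj_exp z1 (ltnSE (ltn_ord k))) -(conj_exp w1 (ltnSE (ltn_ord l))).
ring.
Qed.

Lemma dot_conjv (q : C2 R) : dot (conjv q) q = (nm (q 0 0) ^+ 2 + nm (q 0 1) ^+ 2)%:C.
Proof.
rewrite /dot !mxE !nm_sqr; case: (q 0 0) (q 0 1) => x y [u v].
by apply/eqP; rewrite eq_complex /=; apply/andP; split; apply/eqP; ring.
Qed.

(** Both sides are entire and agree on the torus. *)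
Lemma rpol_ppol (r : R) : (forall p, torus2 R p -> sphere3 r (ppol p)) ->
  forall p, dot (rpol p) (ppol p) = (r ^+ 2)%:C * p 0 0 ^+ N * p 0 1 ^+ N.
Proof.
move=> hS p.
pose G q := dot (rpol q) (ppol q) - (r ^+ 2)%:C * q 0 0 ^+ N * q 0 1 ^+ N.
(* any polydisc around (1, 1) large enough to contain p within a quarter of its radius *)
pose rho := 4 * (nm (p 0 0) + nm (p 0 1) + 2).
have n0 := nm_ge0 (p 0 0); have n1 := nm_ge0 (p 0 1).
apply/eqP; rewrite -subr_eq0; apply/eqP.
apply: (@torus_zero R G rho); first by rewrite /rho; lra.
- move=> q _; apply: (@differentiableB _ _ _ (fun q => dot (rpol q) (ppol q))).
    exact: (differentiable_dot (differentiable_rpol q) (differentiable_ppol q)).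
  exact: differentiable_mono.
- move=> q _ tq; rewrite /G rpol_torus // dotZl dot_conjv (sphere3_nm (hS q tq)).
  ring.
apply: ord2P; rewrite !mxE /=.
  have := nmD (p 0 0) (- 1); rewrite nmN (nm_real 1) normr1 /rho => h; lra.
have := nmD (p 0 1) (- 1); rewrite nmN (nm_real 1) normr1 /rho => h; lra.
Qed.

End PolynomialMaps.

Section Expansion.
Variable R : realType.
Local Notation C := (Cplx R).

(** The exponent bound is taken of the form [N.+1] so that the monomials [z] and
    [w] are within range. *)
Lemma polynomial_onE (W : set (C2 R)) (Phi : C2 R -> C2 R) :
  polynomial_on W Phi -> exists N a, forall p, W p -> Phi p = ppol N.+1 a p.
Proof.
move=> [P hP].
pose N := maxn (\max_(j < 2) size (P j))%N
  (\max_(j < 2) \max_(l < size (P j)) size ((P j)`_l)%R)%N.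
have h1 j : (size (P j) <= N)%N.
  by rewrite leq_max (leq_bigmax (F := fun j => size (P j)) j).
have h2 j l : (size ((P j)`_l)%R <= N)%N.
  have [hl|hl] := ltnP l (size (P j)); last by rewrite nth_default // size_poly0.
  rewrite leq_max; apply/orP; right.
  apply: leq_trans (leq_bigmax
    (F := fun j => (\max_(l < size (P j)) size ((P j)`_l)%R)%N) j).
  exact: (leq_bigmax (F := fun l : 'I_(size (P j)) => size ((P j)`_l)%R) (Ordinal hl)).
exists N, (fun j k l => (P j)`_l`_k) => p Wp; apply/rowP => j; rewrite hP // !mxE.
have h3 : (size (P j) <= N.+2)%N by rewrite (leq_trans (h1 j)) // leqW // leqW.
rewrite (horner_coef_wide _ h3) horner_sum exchange_big /=; apply: eq_bigr => l _.
have h4 : (size ((P j)`_l)%R <= N.+2)%N by rewrite (leq_trans (h2 j l)) // leqW // leqW.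
rewrite hornerM -polyC_exp hornerC (horner_coef_wide _ h4) mulr_suml.
by apply: eq_bigr => k _.
Qed.

End Expansion.

(** * First-order terms at the origin *)

Section FirstOrder.
Variable R : realType.
Local Notation C := (Cplx R).

(** If the pairing of [S t] with [V (t v)] is [o(t)], its first-order term
    vanishes. *)
Lemma pairing_limit (S : C -> C2 R) (V : C2 R -> C2 R) (e : C -> C) (v : C2 R) :
  {for 0, continuous S} -> differentiable V 0 -> V 0 = 0 ->
  {for 0, continuous e} -> e 0 = 0 ->
  (\forall t \near (0 : C), dot (S t) (V (t *: v)) = t * e t) ->
  dot (S 0) ('d V 0 v) = 0.
Proof.
move=> cS dV V0 ce e0 hS.
have hV : (fun h : C => h^-1 *: V (h *: v)) @ 0^' --> 'd V 0 v.
  have hd : derivable V 0 v := diff_derivable dV.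
  have E : (fun h : C => h^-1 *: ((V \o shift 0) (h *: v) - V 0)) =
      (fun h => h^-1 *: V (h *: v)).
    by apply/funext => h; rewrite /= V0 subr0 addr0.
  rewrite -(deriveE v dV) -E; exact: hd.
have centry (u : C -> C2 R) (l : C2 R) j :
    u @ 0^' --> l -> (fun t => u t 0 j : C) @ 0^' --> (l 0 j : C).
  move=> hu; have hc := differentiable_continuous (@differentiable_coord C 1 2 l 0 j).
  exact: (cvg_comp _ _ hu hc).
have cS' : S @ 0^' --> S 0.
  by apply: cvg_trans cS; apply: cvg_app; exact: cvg_within.
have ce' : e @ 0^' --> e 0.
  by apply: cvg_trans ce; apply: cvg_app; exact: cvg_within.
rewrite e0 in ce'.
have h1 : (fun t => dot (S t) (t^-1 *: V (t *: v))) @ 0^' --> dot (S 0) ('d V 0 v).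
  have c0 := centry _ _ 0 cS'; have c1 := centry _ _ 1 cS'.
  have d0 := centry _ _ 0 hV; have d1 := centry _ _ 1 hV.
  exact: (cvgD (cvgM c0 d0) (cvgM c1 d1)).
have h2 : (fun t => dot (S t) (t^-1 *: V (t *: v))) @ 0^' --> (0 : C).
  apply: cvg_trans ce'; apply: near_eq_cvg.
  have hS' : \forall t \near (0 : C)^', dot (S t) (V (t *: v)) = t * e t.
    exact: cvg_within hS.
  have hn : \forall t \near (0 : C)^', t != 0 by exact: nbhs_dnbhs_neq.
  near=> t.
  rewrite dotZr (near hS' t) // mulrA mulVf ?mul1r //.
  by near: t.
exact: (cvg_unique _ h1 h2).
Unshelve. all: by end_near. Qed.

End FirstOrder.

(** * Linearity of the map *)

Section NonlinearCase.
Variable R : realType.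
Local Notation C := (Cplx R).

Lemma poly_all0 (p : {poly C}) : (forall x, p.[x] = 0) -> p = 0.
Proof.
move=> h; pose rs := [seq (i%:R : C) | i <- iota 0 (size p)].
apply: (@roots_geq_poly_eq0 _ p rs).
- by apply/allP => x _; apply/rootP.
- by rewrite map_inj_uniq ?iota_uniq // => i j /eqP; rewrite eqr_nat => /eqP.
- by rewrite size_map size_iota.
Qed.

Lemma diff_jacobian (f : C2 R -> C2 R) (p v : C2 R) : differentiable f p ->
  'd f p v = v *m 'J f p.
Proof. by move=> df; rewrite -deriveEjacobian // deriveE. Qed.

Lemma diff_jacobian_comp (f X : C2 R -> C2 R) (p v : C2 R) :
  differentiable f p -> differentiable X (f p) ->
  'd (X \o f) p v = v *m 'J f p *m 'J X (f p).
Proof.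
move=> df dX.
have E : 'd (X \o f) p v = 'd X (f p) ('d f p v) := congr1 (@^~ v) (diff_comp df dX).
by rewrite E (diff_jacobian _ dX) (diff_jacobian _ df).
Qed.

Lemma mulmxE2 (x : C2 R) (A : 'M[C]_2) j : (x *m A) 0 j = x 0 0 * A 0 j + x 0 1 * A 1 j.
Proof.
rewrite mxE !big_ord_recl big_ord0 addr0.
by congr (x 0 _ * A _ j + x 0 _ * A _ j); apply/val_inj.
Qed.

(** If every vector is parallel to its image, the matrix is scalar. *)
Lemma scalar_of_wedge (A : 'M[C]_2) :
  (forall x : C2 R, x 0 0 * (x *m A) 0 1 - x 0 1 * (x *m A) 0 0 = 0) ->
  A = (A 0 0)%:M.
Proof.
move=> h.
have h0 : A 0 1 = 0.
  by have := h (pt 1 0); rewrite !mulmxE2 !mxE /= !(mul0r, mul1r, addr0, subr0).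
have h1 : A 1 0 = 0.
  have := h (pt 0 1); rewrite !mulmxE2 !mxE /= !(mul0r, mul1r, add0r, sub0r).
  by move/eqP; rewrite oppr_eq0 => /eqP.
have h2 := h (pt 1 1); rewrite !mulmxE2 !mxE /= !mul1r h0 h1 add0r addr0 in h2.
apply/matrixP; apply: ord2P; apply: ord2P; rewrite !mxE /= ?mulr1n ?mulr0n //.
by move/eqP: h2; rewrite subr_eq0 => /eqP.
Qed.

Lemma siegel_not_scalar (c l m : C) :
  char_poly (c%:M : 'M[C]_2) = ('X - l%:P) * ('X - m%:P) -> ~ (l / m < 0).
Proof.
have -> : char_poly (c%:M : 'M[C]_2) = ('X - c%:P) ^+ 2.
  rewrite /char_poly.
  have -> : char_poly_mx (c%:M : 'M[C]_2) = ('X - c%:P)%:M.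
    by rewrite /char_poly_mx map_scalar_mx /= -raddfB.
  by rewrite det_scalar.
move=> E.
have hl : l = c.
  have := congr1 (horner^~ l) E; rewrite /= !hornerE subrr mul0r => /eqP.
  by rewrite expf_eq0 /= subr_eq0 => /eqP.
have hm : m = c.
  have := congr1 (horner^~ m) E; rewrite /= !hornerE subrr mulr0 => /eqP.
  by rewrite expf_eq0 /= subr_eq0 => /eqP.
rewrite hl hm; have [->|c0] := eqVneq c 0; first by rewrite mul0r ltxx.
by rewrite divff // => /(lt_trans ltr01); rewrite ltxx.
Qed.

Variables (N : nat) (a : 'I_2 -> nat -> nat -> C).

(** The quotient of [rpol (t v)] by [t ^ (2 N - D)], where [D] bounds the total
    degree; at [t = 0] it is the lowest homogeneous part of [rpol] at [v]. *)
Definition rscaled (D : nat) (v : C2 R) (t : C) : C2 R :=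
  \row_j \sum_(k < N.+1) \sum_(l < N.+1)
    (if (k + l <= D)%N then (conjc (a j k l) : C) * t ^+ (D - (k + l)) else 0) *
    v 0 0 ^+ (N - k) * v 0 1 ^+ (N - l).

Lemma rpol_scaled D (v : C2 R) (t : C) : (D <= N + N)%N ->
  (forall j k l, (k <= N)%N -> (l <= N)%N -> (D < k + l)%N -> a j k l = 0) ->
  rpol N a (t *: v) = t ^+ (N + N - D) *: rscaled D v t.
Proof.
move=> DN h; apply/rowP => j; rewrite !mxE mulr_sumr; apply: eq_bigr => k _.
rewrite mulr_sumr; apply: eq_bigr => l _.
have kN := ltnSE (ltn_ord k); have lN := ltnSE (ltn_ord l).
case: (leqP (k + l) D) => hkl; last by rewrite h // conjc0 !mul0r mulr0.
rewrite !exprMn.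
have -> : t ^+ (N - k) * v 0 0 ^+ (N - k) = v 0 0 ^+ (N - k) * t ^+ (N - k).
  by rewrite mulrC.
have e : t ^+ (N + N - D) * t ^+ (D - (k + l)) = t ^+ (N - k) * t ^+ (N - l).
  by rewrite -!exprD; congr (t ^+ _); move: kN lN hkl DN; lia.
rewrite !mulrA -[RHS]mulrA [RHS]mulrC.
transitivity (t ^+ (N - k) * t ^+ (N - l) *
  ((conjc (a j k l) : C) * v 0 0 ^+ (N - k) * v 0 1 ^+ (N - l))); first ring.
rewrite -e; ring.
Qed.

Lemma differentiable_rscaled D v t : differentiable (rscaled D v) t.
Proof.
apply: differentiable_row => j; apply: differentiable_bigsum => k.
apply: differentiable_bigsum => l.
case: (k + l <= D)%N; last first.
  exact: (@differentiable_cst C C C (0 * v 0 0 ^+ (N - k) * v 0 1 ^+ (N - l)) t).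
have hc c := @differentiable_cst C C C c t.
have ht : differentiable (fun t : C => t) t by [].
have := differentiableM (differentiableM (differentiableM (hc (conjc (a j k l) : C))
  (differentiable_pow (D - (k + l)) ht)) (hc (v 0 0 ^+ (N - k)))) (hc (v 0 1 ^+ (N - l))).
by [].
Qed.

(** Two vectors annihilated by [q] are parallel unless [q = 0]. *)
Lemma wedge_elim (q x y : C2 R) : dot q x = 0 -> dot q y = 0 ->
  forall j, q 0 j * (x 0 0 * y 0 1 - x 0 1 * y 0 0) = 0.
Proof.
rewrite /dot => h1 h2; apply: ord2P.
  transitivity ((q 0 0 * x 0 0 + q 0 1 * x 0 1) * y 0 1 -
    (q 0 0 * y 0 0 + q 0 1 * y 0 1) * x 0 1); first ring.
  by rewrite h1 h2; ring.
transitivity ((q 0 0 * y 0 0 + q 0 1 * y 0 1) * x 0 0 -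
    (q 0 0 * x 0 0 + q 0 1 * x 0 1) * y 0 0); first ring.
by rewrite h1 h2; ring.
Qed.

(** If some coefficient of total degree above 1 were not zero, the leading
    orders of both pairings would force the linear part of [X] to be scalar. *)
Lemma nonlinear_impossible (r : R) (X : C2 R -> C2 R) (l m : C) :
  ppol N a 0 = 0 -> 'J (ppol N a) 0 \in unitmx ->
  (forall p, dot (rpol N a p) (ppol N a p) = (r ^+ 2)%:C * p 0 0 ^+ N * p 0 1 ^+ N) ->
  differentiable X 0 -> X 0 = 0 ->
  (\forall p \near (0 : C2 R), dot (rpol N a p) (X (ppol N a p)) = 0) ->
  char_poly ('J X 0) = ('X - l%:P) * ('X - m%:P) -> l / m < 0 ->
  forall j k n, (k <= N)%N -> (n <= N)%N -> (1 < k + n)%N -> a j k n = 0.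
Proof.
move=> f0 Junit hrf dX X0 hrX hchar hneg j0 k0 n0 k0N n0N kn0.
apply/eqP/negPn/negP => a0.
set f := ppol N a in f0 Junit hrf hrX *.
have df p : differentiable f p by exact: differentiable_ppol.
clearbody f.
pose P d := [exists j : 'I_2, [exists k : 'I_N.+1, [exists n : 'I_N.+1,
  (k + n == d)%N && (a j k n != 0)]]].
have PI j k n : (k <= N)%N -> (n <= N)%N -> a j k n != 0 -> P (k + n)%N.
  move=> hk hn ha; rewrite -ltnS in hk; rewrite -ltnS in hn; apply/existsP; exists j.
  apply/existsP; exists (Ordinal hk); apply/existsP; exists (Ordinal hn).
  by rewrite eqxx ha.
have Pex : exists d, P d by exists (k0 + n0)%N; exact: PI a0.
have Pub d : P d -> (d <= N + N)%N.
  move=> /existsP[j /existsP[k /existsP[n /andP[/eqP <- _]]]].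
  by apply: leq_add; rewrite -ltnS.
(* D is the total degree *)
case: (ex_maxnP Pex Pub) => D PD Dmax.
have DN := Pub _ PD.
have D2 : (1 < D)%N by apply: leq_trans kn0 _; apply: Dmax; exact: PI a0.
have azero j k n : (k <= N)%N -> (n <= N)%N -> (D < k + n)%N -> a j k n = 0.
  move=> hk hn hD; apply/eqP/negPn/negP => /(PI _ _ _ hk hn) /Dmax.
  by rewrite leqNgt hD.
have cS v : {for 0, continuous (rscaled D v)}.
  by apply: differentiable_continuous; exact: differentiable_rscaled.
have s0 v : (0 : C) *: v = 0 :> C2 R by rewrite scale0r.
(* lowest order of the pairing with f; the exponent D.-1 is positive *)
have H1 v : dot (rscaled D v 0) ('d f 0 v) = 0.
  apply: (@pairing_limit R _ f
    (fun t => ((r ^+ 2)%:C * v 0 0 ^+ N * v 0 1 ^+ N) * t ^+ D.-1) v) => //.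
  - apply: differentiable_continuous.
    have ht : differentiable (fun t : C => t) 0 by [].
    by have := differentiableM (@differentiable_cst C C C
      ((r ^+ 2)%:C * v 0 0 ^+ N * v 0 1 ^+ N) 0) (differentiable_pow D.-1 ht).
  - by move: D2; case: (D) => [|[|d]] // _; rewrite expr0n /= mulr0.
  - apply/nbhs_ballP; exists (1 : C) => [|t _] /=; first exact: ltr01.
    have [->|t0] := eqVneq t 0.
      by rewrite s0 f0 mul0r /dot !mxE !mulr0 addr0.
    have := hrf (t *: v); rewrite (rpol_scaled v t DN azero) dotZl !mxE => h.
    apply: (mulfI (expf_neq0 (N + N - D) t0)); rewrite h !exprMn.
    transitivity ((r ^+ 2)%:C * v 0 0 ^+ N * v 0 1 ^+ N * t ^+ (N + N)).
      by rewrite exprD; ring.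
    have -> : t ^+ (N + N) = t ^+ (N + N - D) * (t * t ^+ D.-1).
      by rewrite -exprS prednK ?(ltnW D2) // -exprD subnK.
    ring.
(* lowest order of the pairing with the generator *)
have dX' : differentiable X (f 0) by rewrite f0.
have dXf := differentiable_comp (df 0) dX'.
have H2 v : dot (rscaled D v 0) ('d (X \o f) 0 v) = 0.
  apply: (@pairing_limit R _ (X \o f) (fun=> 0) v) => //.
  - by rewrite /= f0.
  - exact: (@cst_continuous C C 0).
  have [e e0 he] := nbhs_box hrX.
  pose d := e / (nm (v 0 0) + nm (v 0 1) + 1).
  have n0' := nm_ge0 (v 0 0); have n1' := nm_ge0 (v 0 1).
  have d0 : 0 < d by rewrite divr_gt0 //; lra.
  apply/nbhs_ballP; exists (d%:C : C) => [|t]; first by rewrite /= ltcR.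
  rewrite -ball_normE /= sub0r normrN nmE ltcR => td.
  rewrite mulr0; have [->|t0] := eqVneq t 0.
    by rewrite s0 f0 X0 /dot !mxE !mulr0 addr0.
  have hb : box 0 e (t *: v).
    move=> j; rewrite !mxE subr0 nmM.
    move: td; rewrite /d ltr_pdivlMr; last lra.
    apply: le_lt_trans; rewrite ler_wpM2l ?nm_ge0 //.
    by move: j; apply: ord2P; lra.
  have := he _ hb; rewrite /= (rpol_scaled v t DN azero) dotZl => /eqP.
  by rewrite mulf_eq0 (negbTE (expf_neq0 _ t0)) => /eqP.
pose A := 'J X 0; pose B := 'J f 0.
have uE v : 'd f 0 v = v *m B := diff_jacobian v (df 0).
have wE v : 'd (X \o f) 0 v = v *m B *m A.
  by have := diff_jacobian_comp v (df 0) dX'; rewrite f0.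
have H v j : rscaled D v 0 0 j *
    ((v *m B) 0 0 * (v *m B *m A) 0 1 - (v *m B) 0 1 * (v *m B *m A) 0 0) = 0.
  have h1 := H1 v; have h2 := H2 v; rewrite uE in h1; rewrite wE in h2.
  exact: (wedge_elim h1 h2 j).
(* both factors are polynomials in z on the line w = 1 *)
pose qp j : {poly C} := \sum_(k < N.+1) \sum_(n < N.+1)
  (if (k + n == D)%N then (conjc (a j k n) : C) else 0) *: 'X^(N - k).
have qpE j z : (qp j).[z] = rscaled D (pt z 1) 0 0 j.
  rewrite /qp horner_sum mxE; apply: eq_bigr => k _.
  rewrite horner_sum; apply: eq_bigr => n _.
  rewrite hornerZ hornerXn !mxE /= expr1n mulr1; congr (_ * _).
  rewrite leq_eqVlt; have [->|hne] := eqVneq (k + n)%N D.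
    by rewrite subnn expr0 mulr1.
  by case: ltnP => //= hlt; rewrite expr0n subn_eq0 leqNgt hlt mulr0.
pose M := B *m A.
pose lin (T : 'M[C]_2) i : {poly C} := (T 0 i)%:P * 'X + (T 1 i)%:P.
have linE T i z : (lin T i).[z] = (pt z 1 *m T) 0 i.
  by rewrite mulmxE2 !mxE /= mul1r /lin !hornerE mulrC.
pose dp := lin B 0 * lin M 1 - lin B 1 * lin M 0.
have prod0 j : qp j * dp = 0.
  apply: poly_all0 => z; rewrite hornerM hornerD hornerN !hornerM qpE !linE.
  by rewrite /M mulmxA; exact: H.
(* if dp is not zero, every qp j is, which contradicts the choice of D *)
have [dp0|dp0] := eqVneq dp 0; last first.
  have /existsP[j /existsP[k /existsP[n /andP[/eqP knD an]]]] := PD.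
  have : qp j = 0.
    by move/eqP: (prod0 j); rewrite mulf_eq0 (negbTE dp0) orbF => /eqP.
  move=> /(congr1 (fun p : {poly C} => p`_(N - k))); rewrite coef0 /qp coef_sum.
  rewrite (bigD1 k) //= [X in _ + X]big1 ?addr0; last first.
    move=> i ik; rewrite coef_sum big1 // => n' _; rewrite coefZ coefXn.
    have -> : (N - k == N - i)%N = false; last by rewrite mulr0.
    apply/negbTE; apply: contra ik => /eqP e; apply/eqP/val_inj => /=.
    by have := ltn_ord i; have := ltn_ord k; move: e; lia.
  rewrite coef_sum (bigD1 n) //= big1 ?addr0; last first.
    move=> i ik; case: eqP => [e|_]; last by rewrite coefZ mul0r.
    by case/eqP: ik; apply/val_inj => /=; move: e knD; lia.
  rewrite knD eqxx coefZ coefXn eqxx mulr1 => /eqP.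
  by rewrite conjc_eq0 (negbTE an).
move: hchar; rewrite -/A => hchar.
have Bu : B \in unitmx by exact: Junit.
clear uE wE H1 H2 H; clearbody A B.
pose b (x y : C2 R) := x 0 0 * (y *m A) 0 1 - x 0 1 * (y *m A) 0 0.
have bz z : b (pt z 1 *m B) (pt z 1 *m B) = 0.
  have := congr1 (horner^~ z) dp0; rewrite /= horner0 hornerD hornerN !hornerM !linE.
  by rewrite /M mulmxA.
pose u0 := pt 1 0 *m B; pose u1 := pt 0 1 *m B.
have ptB z w : pt z w *m B = z *: u0 + w *: u1.
  rewrite /u0 /u1 !scalemxAl -mulmxDl; congr (_ *m B).
  by apply/rowP; apply: ord2P; rewrite !mxE /=; ring.
have bE (x y : C2 R) (z w : C) : b (z *: x + w *: y) (z *: x + w *: y) =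
    z ^+ 2 * b x x + z * w * (b x y + b y x) + w ^+ 2 * b y y.
  by rewrite /b !mulmxE2 !mxE; ring.
(* the quadratic form b vanishes at three points of the line w = 1, hence everywhere *)
have z0 := bz 0; have z1 := bz 1; have z2 := bz (-1).
rewrite ptB bE in z0; rewrite ptB bE in z1; rewrite ptB bE in z2.
clearbody u0 u1.
have b11 : b u1 u1 = 0 by rewrite -z0; ring.
have b00 : b u0 u0 = 0.
  have : 2 * b u0 u0 = 0 by rewrite -[RHS](subrr 0) -{1}z1 -[in RHS]oppr0 -z2 b11; ring.
  by move/eqP; rewrite mulf_eq0 pnatr_eq0 => /eqP.
have b01 : b u0 u1 + b u1 u0 = 0 by rewrite -z1 b00 b11; ring.
have bx x : b x x = 0.
  have -> : x = (x *m invmx B) *m B by rewrite (mulmxKV Bu).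
  by rewrite (pt_eta (x *m invmx B)) ptB bE b00 b01 b11 !mulr0 !addr0.
move: hchar; rewrite (scalar_of_wedge bx) => /siegel_not_scalar; exact.
Qed.

End NonlinearCase.

(** * Linear maps *)

Section LinearCase.
Variable R : realType.
Local Notation C := (Cplx R).

Lemma ppol_linear N (a : 'I_2 -> nat -> nat -> C) :
  (forall j k n, (k <= N.+1)%N -> (n <= N.+1)%N -> (1 < k + n)%N -> a j k n = 0) ->
  ppol N.+1 a 0 = 0 ->
  exists M : 'M[C]_2, forall p, ppol N.+1 a p = p *m M.
Proof.
move=> ha f0.
have E p j : ppol N.+1 a p 0 j = a j 0%N 0%N + a j 1%N 0%N * p 0 0 + a j 0%N 1%N * p 0 1.
  rewrite mxE big_ord_recl [X in X + _ = _]big_ord_recl.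
  rewrite [X in _ + X + _ = _]big_ord_recl [X in _ + (_ + X) + _ = _]big1; last first.
    by move=> i _; rewrite ha ?mul0r //=; have := ltn_ord i; rewrite /bump /=; lia.
  rewrite [X in _ + X = _]big_ord_recl [X in _ + (X + _) = _]big_ord_recl.
  rewrite [X in _ + (_ + X + _) = _]big1; last first.
    by move=> i _; rewrite ha ?mul0r //=; have := ltn_ord i; rewrite /bump /=; lia.
  rewrite [X in _ + (_ + X) = _]big1; last first.
    move=> i _; rewrite big1 // => n _.
    by rewrite ha ?mul0r //=; have := ltn_ord i; have := ltn_ord n; rewrite /bump /=; lia.
  rewrite /bump /= !expr0 !expr1; ring.
have a00 j : a j 0%N 0%N = 0.
  by have := E 0 j; rewrite f0 !mxE !mulr0 !addr0.
exists (\matrix_(i, j) (if i == 0 then a j 1%N 0%N else a j 0%N 1%N)) => p.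
apply/rowP => j; rewrite (E p j) mulmxE2 a00 !mxE /=; ring.
Qed.

Lemma differentiable_mulmx (M : 'M[C]_2) p : differentiable (fun q : C2 R => q *m M) p.
Proof.
have -> : (fun q : C2 R => q *m M) =
    (fun q => \row_j (q 0 0 * M 0 j + q 0 1 * M 1 j)).
  by apply/funext => q; apply/rowP => j; rewrite mulmxE2 mxE.
apply: differentiable_row => j.
have h0 := @differentiable_coord C 1 2 p 0 0.
have h1 := @differentiable_coord C 1 2 p 0 1.
have hc c := @differentiable_cst C (C2 R) C c p.
exact: (differentiableD (differentiableM h0 (hc _)) (differentiableM h1 (hc _))).
Qed.

Lemma diff_mulmx (M : 'M[C]_2) (p v : C2 R) : 'd (fun q : C2 R => q *m M) p v = v *m M.
Proof.
have := @diff_lin C (C2 R) (C2 R) (mulmxr M) p.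
move=> /(_ (fun q => differentiable_continuous (differentiable_mulmx M q))) E.
exact: (congr1 (@^~ v) E).
Qed.

(** The derivative of a local left inverse inverts the Jacobian matrix. *)
Lemma jacobian_unit (f g : C2 R -> C2 R) (p : C2 R) :
  differentiable f p -> differentiable g (f p) ->
  (\forall q \near p, g (f q) = q) -> 'J f p \in unitmx.
Proof.
move=> df dg hgf.
suff E : 'J f p *m 'J g (f p) = 1%:M.
  exact: (mulmx1_unit E).1.
apply/row_matrixP => i; rewrite !rowE mulmx1 mulmxA.
set v := delta_mx 0 i.
have dgf := differentiable_comp df dg.
rewrite -(diff_jacobian_comp v df dg) -(deriveE v dgf).
have -> : 'D_v (g \o f) p = 'D_v id p.
  apply: near_eq_derive.
  exact: hgf.
by rewrite derive_id.
Qed.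

Lemma mulmx_jacobian_unit (M : 'M[C]_2) (p : C2 R) :
  'J (fun q : C2 R => q *m M) p \in unitmx -> M \in unitmx.
Proof.
suff -> : 'J (fun q : C2 R => q *m M) p = M by [].
apply/row_matrixP => i; rewrite !rowE.
by rewrite -(diff_jacobian _ (differentiable_mulmx M p)) diff_mulmx.
Qed.

Variables (M : 'M[C]_2) (r : R).
Local Notation a := (row 0 M).
Local Notation b := (row 1 M).

Lemma mulmx_rows (p : C2 R) : p *m M = p 0 0 *: a + p 0 1 *: b.
Proof. by apply/rowP => j; rewrite mulmxE2 !mxE. Qed.

Hypothesis torus_sphere : forall p, torus2 R p -> sphere3 r (p *m M).

(** The constant norm is tested at the points [(1, 1)], [(1, -1)] and [(1, i)]. *)
Lemma rows_orthogonal : dot (conjv a) b = 0.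
Proof.
pose S := dot (conjv a) b.
have key (w : C) : `|w| = 1 ->
    (dot (conjv a) a + dot (conjv b) b) + (w * S + conjc (w * S)) = (r ^+ 2)%:C.
  move=> w1; have tp : torus2 R (pt 1 w) by rewrite /torus2 /= !mxE /= normr1.
  have := sphere3_nm (torus_sphere tp).
  move=> /(congr1 (fun x : R => x%:C)); rewrite -dot_conjv => <-.
  rewrite mulmx_rows /S /dot !mxE /= !mul1r.
  rewrite !(rmorphM (@conjc R)) !(rmorphD (@conjc R)) !(rmorphM (@conjc R)) /= !conjcK.
  have ww := conj_unit w1.
  set A0 := M 0 0; set A1 := M 0 1; set B0 := M 1 0; set B1 := M 1 1.
  have e : conjc B0 * B0 + conjc B1 * B1 =
     (w * conjc w) * (conjc B0 * B0 + conjc B1 * B1) :> C by rewrite ww mul1r.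
  rewrite e; ring.
have h1 := key 1 (normr1 _); have h2 := key (-1) (normrN1 _).
have h3 := key 'i (norm_i R).
apply/eqP; rewrite eq_complex /= -/S.
move: h1 h2 h3; rewrite !dot_conjv.
case: (S) => x y /=; rewrite -!rmorphD /=.
move=> /(congr1 (@complex.Re R)) /= h1 /(congr1 (@complex.Re R)) /= h2.
move=> /(congr1 (@complex.Re R)) /= h3.
by apply/andP; split; apply/eqP; lra.
Qed.

(** For [Phi p = z a + w b], the value at [p] of [w conj a + z conj b]; on the
    torus it is [z w] times the conjugate of [Phi p]. *)
Definition linear_form_vec (p : C2 R) : C2 R := p 0 1 *: conjv a + p 0 0 *: conjv b.

Lemma linear_form_vec_torus p : torus2 R p ->
  linear_form_vec p = (p 0 0 * p 0 1) *: conjv (p *m M).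
Proof.
move=> [/= z1 w1]; rewrite mulmx_rows; apply/rowP => j; rewrite !mxE.
rewrite (rmorphD (@conjc R)) !(rmorphM (@conjc R)) /=.
have zz := conj_unit z1; have ww := conj_unit w1.
transitivity ((p 0 0 * conjc (p 0 0)) * p 0 1 * conjc (M 0 j) +
  (p 0 1 * conjc (p 0 1)) * p 0 0 * conjc (M 1 j)).
  by rewrite zz ww !mul1r.
ring.
Qed.

Lemma differentiable_linear_form_vec p : differentiable linear_form_vec p.
Proof.
have h0 := @differentiable_coord C 1 2 p 0 0.
have h1 := @differentiable_coord C 1 2 p 0 1.
exact: (differentiableD (differentiableZl (conjv a) h1) (differentiableZl (conjv b) h0)).
Qed.

(** Squared Euclidean norm. *)
Definition sqnorm (q : C2 R) : R := nm (q 0 0) ^+ 2 + nm (q 0 1) ^+ 2.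

Lemma sqnorm_gt0 q : q != 0 -> 0 < sqnorm q.
Proof.
move=> q0; rewrite lt_neqAle addr_ge0 ?sqr_ge0 // andbT eq_sym.
apply: contra q0; rewrite paddr_eq0 ?sqr_ge0 // !sqrf_eq0 !nm_eq0 => /andP[/eqP h0 /eqP h1].
by apply/eqP/rowP; apply: ord2P; rewrite mxE.
Qed.

(** By orthogonality of the rows, the form [w conj a + z conj b] is a Siegel
    form in linear coordinates. *)
Lemma linear_form_vecE (x u : C2 R) : b != 0 ->
  dot (linear_form_vec x) (u *m M) =
  (sqnorm b)%:C * siegel_form ((- (sqnorm a / sqnorm b))%:C) x u.
Proof.
move=> /sqnorm_gt0 b0.
have hba : dot (conjv b) a = 0.
  have := congr1 (@conjc R) rows_orthogonal; rewrite conjc0 => <-.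
  rewrite /dot !mxE (rmorphD (@conjc R)) !(rmorphM (@conjc R)) /= !conjcK; ring.
have dD (c1 c2 : C) (q1 q2 q : C2 R) :
    dot (c1 *: q1 + c2 *: q2) q = c1 * dot q1 q + c2 * dot q2 q.
  by rewrite /dot !mxE; ring.
have dDr (c1 c2 : C) (q1 q2 q : C2 R) :
    dot q (c1 *: q1 + c2 *: q2) = c1 * dot q q1 + c2 * dot q q2.
  by rewrite /dot !mxE; ring.
rewrite mulmx_rows /linear_form_vec dD !dDr rows_orthogonal hba !dot_conjv.
rewrite -/(sqnorm a) -/(sqnorm b) /siegel_form rmorphN rmorphM fmorphV /=.
have b1 : (sqnorm b)%:C != 0 :> C by rewrite eq_complex /= eqxx andbT gt_eqF.
by field.
Qed.

(** The kernel of a nonzero linear form on [C^2] is a line. *)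
Lemma kernel_line (q x v : C2 R) : q != 0 -> x != 0 -> dot q x = 0 -> dot q v = 0 ->
  exists c, v = c *: x.
Proof.
move=> q0 x0 hx hv.
have W : x 0 0 * v 0 1 - x 0 1 * v 0 0 = 0.
  apply/eqP; apply: contraNT q0 => wn.
  have h := wedge_elim hx hv; apply/eqP/rowP => j; rewrite mxE.
  by move/eqP: (h j); rewrite mulf_eq0 (negbTE wn) orbF => /eqP.
have [x00|x00] := eqVneq (x 0 0) 0; last first.
  exists (v 0 0 / x 0 0); apply/rowP; apply: ord2P; rewrite mxE ?divfK //.
  apply: (mulfI x00); move/eqP: W; rewrite subr_eq0 => /eqP ->.
  by field.
have x01 : x 0 1 != 0.
  apply: contraNneq x0 => x01; apply/eqP/rowP; apply: ord2P; rewrite mxE //.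
exists (v 0 1 / x 0 1); apply/rowP; apply: ord2P; rewrite mxE ?divfK //.
apply: (mulfI x01); move/eqP: W; rewrite subr_eq0 x00 mul0r eq_sym => /eqP ->.
by rewrite !mulr0.
Qed.

End LinearCase.

(** * Linearization of the foliation *)

Section LinearFoliation.
Variable R : realType.
Local Notation C := (Cplx R).

Lemma siegel_form_nondegenerate (tau : C) (x : C2 R) : tau != 0 ->
  (forall u, siegel_form tau x u = 0) -> x = 0.
Proof.
move=> t0 h; have h0 := h (pt 0 1); have h1 := h (pt 1 0).
rewrite /siegel_form !mxE /= mulr1 !mulr0 subr0 in h0.
rewrite /siegel_form !mxE /= mulr1 mulr0 sub0r in h1.
apply/rowP; apply: ord2P; rewrite [RHS]mxE //.
by move/eqP: h1; rewrite oppr_eq0 mulf_eq0 (negbTE t0) => /eqP.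
Qed.

(** The coordinate change is the inverse of the linear map, restricted to a
    neighbourhood of the origin on which the generator has no other zero. *)
Lemma linear_siegel_linearizable (D : set (C2 R)) (F : foliation D) (M : 'M[C]_2)
    (r : R) (W : set (C2 R)) (k : fol_chart F) :
  M \in unitmx -> (forall p, torus2 R p -> sphere3 r (p *m M)) ->
  (exists2 e, 0 < e &
     box 0 e `<=` annihilates W F (fun p => p *m M) (linear_form_vec M)) ->
  fol_dom k 0 -> fol_gen k 0 = 0 -> siegel_linearizable_at0 F.
Proof.
move=> Mu hT [e e0 he] k0 g0.
pose Psi := fun q : C2 R => q *m invmx M.
pose K := fun q : C2 R => q *m M.
have PsiK q : K (Psi q) = q by rewrite /K /Psi mulmxKV.
have KPsi q : Psi (K q) = q by rewrite /K /Psi mulmxK.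
have dPsi q : differentiable Psi q := differentiable_mulmx (invmx M) q.
have dK q : differentiable K q := differentiable_mulmx M q.
have Psi0 : Psi 0 = 0 by rewrite /Psi mul0mx.
have nz i : row i M != 0.
  apply/eqP => hi; have : row i M *m invmx M = 0 by rewrite hi mul0mx.
  rewrite -row_mul mulmxV // => /(congr1 (fun v : C2 R => v 0 i)).
  by rewrite !mxE eqxx => /eqP; rewrite oner_eq0.
have a0 := sqnorm_gt0 (nz 0); have b0 := sqnorm_gt0 (nz 1).
pose tau := - (sqnorm (row 0 M) / sqnorm (row 1 M)).
have b1 : (sqnorm (row 1 M))%:C != 0 :> C by rewrite eq_complex /= eqxx andbT gt_eqF.
have formE q v : dot (linear_form_vec M (Psi q)) v =
    (sqnorm (row 1 M))%:C * siegel_form tau%:C (Psi q) (Psi v).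
  by rewrite -{1}(PsiK v); exact: linear_form_vecE hT _ _ (nz 1).
pose S : set (C2 R) := [set q | [/\ box 0 e (Psi q), fol_dom k q &
  q != 0 -> fol_gen k q != 0]].
have nS : nbhs (0 : C2 R) S.
  have n1 : nbhs (0 : C2 R) (Psi @^-1` (box 0 e)).
    apply: (differentiable_continuous (dPsi 0)); rewrite Psi0; exact: box_nbhs.
  have n2 : nbhs (0 : C2 R) (fol_dom k).
    by apply: open_nbhs_nbhs; split => //; exact: fol_open.
  have n3 : nbhs (0 : C2 R) [set q | q != 0 -> fol_gen k q != 0].
    exact: (fol_isolated k0 g0).
  by apply: filterS (filterI n1 (filterI n2 n3)) => q [h1 [h2 h3]].
exists (S^°), (K @^-1` (S^°)), Psi, tau; split.
- split.
  + exact: nS.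
  + move=> q /interior_subset[_ kq _]; rewrite -(fol_cover F); by exists k.
  + split.
    * exact: open_interior.
    * by apply: open_comp; [move=> q _; exact: (differentiable_continuous (dK q))|
        exact: open_interior].
    * by move=> q _; exact: dPsi.
    * apply/seteqP; split => [_ [q hq <-]|q hq]; first by rewrite /preimage /= PsiK.
      by exists (K q) => //; exact: KPsi.
    * exists K; split; first by move=> q _; exact: dK.
        apply/seteqP; split => [_ [q hq <-]//|q hq].
        by exists (Psi q); rewrite /preimage /= PsiK.
      by move=> q _; exact: PsiK.
  + exact: Psi0.
- by rewrite oppr_lt0 divr_gt0.
move=> q /interior_subset[bq kq gq] q0.
have [_ hann] := he _ bq.
have Psiq0 : Psi q != 0.
  by apply: contraNneq q0 => h; rewrite -(PsiK q) h /K mul0mx.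
have ann (l : fol_chart F) : fol_dom l q -> dot (linear_form_vec M (Psi q)) (fol_gen l q) = 0.
  by move=> lq; have := hann l; rewrite -/(K (Psi q)) PsiK; exact.
have form0 v : (siegel_form tau%:C (Psi q) ('d Psi q v) = 0) <->
    dot (linear_form_vec M (Psi q)) v = 0.
  rewrite diff_mulmx formE; split => [->|/eqP]; first by rewrite mulr0.
  by rewrite mulf_eq0 (negbTE b1) => /eqP.
apply/seteqP; split => [v [l lq [c ->]]|v hv] /=.
  by apply/form0; rewrite dotZr ann // mulr0.
exists k => //; apply: (@kernel_line R (linear_form_vec M (Psi q))).
- apply: contraNneq Psiq0 => L0; apply/eqP.
  apply: (siegel_form_nondegenerate (tau := tau%:C)).
    by rewrite eq_complex /= eqxx andbT oppr_eq0 gt_eqF // divr_gt0.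
  move=> u; have := formE q (K u); rewrite KPsi L0 /dot !mxE !mul0r addr0.
  by move=> /esym/eqP; rewrite mulf_eq0 (negbTE b1) => /eqP.
- exact: gq.
- exact: ann.
- exact/form0.
Qed.

End LinearFoliation.

Unset Implicit Arguments.

Theorem theorem3 (R : realType) (W Omega D : set (C2 R)) (Phi : C2 R -> C2 R)
    (r : R) (F : foliation D) :
  biholomorphic W Omega Phi -> polynomial_on W Phi ->
  closed_bidisc R `<=` W -> Phi 0 = 0 ->
  0 < r -> Phi @` torus2 R `<=` sphere3 r ->
  open D -> closure Omega `<=` D ->
  Phi @` torus2 R `<=` complex_tangency F (sphere3 r) ->
  isolated_singularity F 0 -> siegel_at F 0 ->
  (exists U A : 'M[Cplx R]_2,
     U \is unitarymx /\ forall p, W p -> Phi p *m U = p *m A) /\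
  siegel_linearizable_at0 F.
Proof.
move=> [oW _ hPhi PhiW [g [hg _ gK]]] hpol bW P0 _ hT _ OD hM _ hsieg.
have [N [a hexp]] := polynomial_onE hpol.
pose f := ppol N.+1 a.
have W0 : W 0 by apply: bW; rewrite /closed_bidisc /= !mxE normr0 ler01.
have Wt p : torus2 R p -> W p.
  by move=> [z1 w1]; apply: bW; rewrite /closed_bidisc /= z1 w1.
have nW : nbhs (0 : C2 R) W by apply: open_nbhs_nbhs.
have f0 : f 0 = 0 by rewrite /f -hexp.
have OmD : Omega `<=` D by move=> q /subset_closure; exact: OD.
have fS p : torus2 R p -> sphere3 r (f p).
  by move=> tp; rewrite /f -hexp; [apply: hT; exists p|exact: Wt].
have tang p (k : fol_chart F) : torus2 R p -> fol_dom k (Phi p) ->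
    dot (conjv (f p)) (fol_gen k (Phi p)) = 0.
  move=> tp kp; rewrite /f -hexp; last exact: Wt.
  by apply: complex_tangency_dot (kp); apply: hM; exists p.
have [_ [k [l [m [k0 g0 hchar hneg]]]]] := hsieg.
have df p : differentiable f p := @differentiable_ppol R N.+1 a p.
have Junit : 'J f (0 : C2 R) \in unitmx.
  apply: (@jacobian_unit _ _ g) => //.
    by rewrite f0 -P0; apply: hg; rewrite -PhiW; exists 0.
  by apply: filterS nW => q Wq; rewrite /f -hexp // gK.
have dX : differentiable (fol_gen k) 0 by exact: fol_holo.
have nonlin : forall j i n, (i <= N.+1)%N -> (n <= N.+1)%N ->
    (1 < i + n)%N -> a j i n = 0.
  have annT p : torus2 R p -> annihilates W F Phi (rpol N.+1 a) p.
    move=> tp; split; first exact: Wt.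
    by move=> c cp; rewrite rpol_torus // dotZl tang // mulr0.
  have [e e0 he] := foliation_continuation oW hPhi PhiW bW OmD
    (fun p _ => differentiable_rpol N.+1 a p) annT.
  apply: (nonlinear_impossible f0 Junit (rpol_ppol fS) dX g0 _ hchar hneg).
  have nk : nbhs (0 : C2 R) (Phi @^-1` (fol_dom k)).
    apply: (differentiable_continuous (hPhi 0 W0)).
    by apply: open_nbhs_nbhs; rewrite P0; split => //; exact: fol_open.
  apply: filterS (filterI nk (box_nbhs 0 e0)) => q [kq /he[Wq ann]].
  by rewrite -hexp //; exact: ann.
have [M hM'] := ppol_linear nonlin f0.
have PhiM p : W p -> Phi p = p *m M by move=> Wp; rewrite hexp.
have fM : f = (fun p => p *m M) by apply/funext.
have Mu : M \in unitmx by apply: (@mulmx_jacobian_unit _ M 0); rewrite -fM.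
split.
  (* Phi is already linear in the given target coordinates *)
  exists 1%:M, M; split => [|p Wp]; last by rewrite mulmx1 PhiM.
  by apply/unitarymxP; rewrite trmx1 map_mx1 mulmx1.
have MS p : torus2 R p -> sphere3 r (p *m M) by move=> tp; rewrite -hM'; exact: fS.
have annT p : torus2 R p -> annihilates W F Phi (linear_form_vec M) p.
  move=> tp; split; first exact: Wt.
  move=> c cp; rewrite linear_form_vec_torus // dotZl -hM' tang // mulr0 //.
have [e e0 he] := foliation_continuation oW hPhi PhiW bW OmD
  (fun p _ => differentiable_linear_form_vec M p) annT.
apply: (linear_siegel_linearizable Mu MS _ k0 g0).
exists e => // q /he[Wq hq]; split; first exact: Wq.
by move=> c cq; rewrite -PhiM //; apply: hq; rewrite PhiM.
Qed.
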